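(* Let $\mathbb{F}_q$ be the finite field with $q$ elements. For all integers $n\ge m\ge0$, $d\ge0$ and $r\ge1$, $$\bigl|C_{m,d}(\mathbb{P}^n)(\mathbb{F}_{q^r})\bigr|\equiv1\pmod q .$$
   Context: $C_{m,d}(\mathbb{P}^n)$ is the Chow variety over $\mathbb{F}_q$: the reduced projective scheme over $\mathbb{F}_q$, given by Chow forms, whose $\overline{\mathbb{F}}_q$-points correspond to effective algebraic $m$-cycles of degree $d$ in $\mathbb{P}^n_{\overline{\mathbb{F}}_q}$; $C_{m,0}(\mathbb{P}^n)$ is a single rational point. $X(\mathbb{F}_{q^r})$ is the set of $\mathbb{F}_{q^r}$-rational points. *)

(* Defs.v *)
From HB Require Import structures.
From mathcomp Require Import all_boot all_order all_algebra.
From mathcomp Require Import mpoly.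
From mathcomp Require Import boolp classical_sets functions cardinality.

Set Implicit Arguments.
Unset Strict Implicit.
Unset Printing Implicit Defensive.

Import GRing.Theory.
Local Open Scope classical_set_scope.
Local Open Scope ring_scope.

Section ProjectiveVarieties.
Variable K : closedFieldType.

(* The point of the projective space of W with homogeneous coordinates w,
   for w <> 0. *)
Definition proj_point (W : lmodType K) (w : W) : set W :=
  [set c *: w | c in [set c : K | c != 0]].

Variable n : nat.
Implicit Types V : set 'cV[K]_n.+1.

(* A subset of P^n is represented by its punctured affine cone, i.e. by the set
   of all homogeneous coordinate vectors (hence nonzero) of its points. *)
Definition zero_locus (S : set {mpoly K[n.+1]}) : set 'cV[K]_n.+1 :=
  [set x | x != 0 /\ forall f, S f -> f.@[fun i => x i 0] = 0].

Definition proj_closed V : Prop :=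
  exists2 S : set {mpoly K[n.+1]},
    (forall f, S f -> exists e : nat, f \is e.-homog) & V = zero_locus S.

Definition irreducible_closed V : Prop :=
  [/\ proj_closed V, V !=set0 &
      forall A B, proj_closed A -> proj_closed B ->
        V `<=` A `|` B -> V `<=` A \/ V `<=` B].

Definition has_irreducible_chain V (k : nat) : Prop :=
  exists Z : nat -> set 'cV[K]_n.+1,
    (forall i, (i <= k)%N -> irreducible_closed (Z i) /\ Z i `<=` V) /\
    (forall i, (i < k)%N -> Z i `<` Z i.+1).

(* Krull dimension. *)
Definition has_dim V (k : nat) : Prop :=
  has_irreducible_chain V k /\ ~ has_irreducible_chain V k.+1.

(* The rows of u are the equations of k hyperplanes. *)
Definition linear_section V (k : nat) (u : 'M[K]_(k, n.+1)) :
    set 'cV[K]_n.+1 :=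
  V `&` [set x | u *m x = 0].

(* The degree of V of dimension m is the number of points in which V meets m
   general hyperplanes; "general" means off the zero set of a nonzero
   polynomial D in the coefficients of the m equations. *)
Definition has_degree (m : nat) V (e : nat) : Prop :=
  exists2 D : {mpoly K[m * n.+1]}, D != 0 &
    forall u : 'M[K]_(m, n.+1), D.@[mxvec u 0] != 0 ->
      (@proj_point 'cV[K]_n.+1 @` linear_section V u #= `I_e)%card.

Definition irreducible_mpoly (N : nat) (G : {mpoly K[N]}) : Prop :=
  G \isn't a GRing.unit /\
  forall A B : {mpoly K[N]}, G = A * B ->
    A \is a GRing.unit \/ B \is a GRing.unit.

(* For V irreducible of dimension m, the (m+1)-tuples of hyperplanes having a
   common point on V form an irreducible hypersurface; the Chow form of V is
   its irreducible equation, unique up to a scalar. The variable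
   [mxvec_index i j] is the j-th coefficient of the i-th hyperplane. *)
Definition is_chow_form (m : nat) V (G : {mpoly K[m.+1 * n.+1]}) : Prop :=
  irreducible_mpoly G /\
  forall u : 'M[K]_(m.+1, n.+1),
    G.@[mxvec u 0] = 0 <-> linear_section V u !=set0.

(* The formal sum of the mult i times comp i. *)
Record cycle := Cycle {
  ncomp : nat;
  comp : 'I_ncomp -> set 'cV[K]_n.+1;
  mult : 'I_ncomp -> nat }.

Definition is_effective_cycle (m : nat) (Z : cycle) : Prop :=
  forall i : 'I_(ncomp Z),
    irreducible_closed (comp i) /\ has_dim (comp i) m.

Definition cycle_has_degree (m : nat) (Z : cycle) (d : nat) : Prop :=
  exists2 e : 'I_(ncomp Z) -> nat,
    (forall i, has_degree m (comp i) (e i)) &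
    d = (\sum_(i < ncomp Z) mult i * e i)%N.

Definition is_cycle_chow_form (m : nat) (Z : cycle)
    (G : {mpoly K[m.+1 * n.+1]}) : Prop :=
  exists2 g : 'I_(ncomp Z) -> {mpoly K[m.+1 * n.+1]},
    (forall i, is_chow_form (comp i) (g i)) &
    G = \prod_(i < ncomp Z) g i ^+ mult i.

(* Forms of degree d in the coefficients of each of the m + 1 hyperplanes. *)
Definition multihomogeneous (m d : nat) (G : {mpoly K[m.+1 * n.+1]}) : Prop :=
  forall mu : 'X_{1..m.+1 * n.+1}, mu \in msupp G ->
    forall i : 'I_m.+1, (\sum_(j < n.+1) mu (mxvec_index i j) = d)%N.

(* The K-points of C_{m,d}(P^n), inside the projective space of multihomogeneous
   forms of degree d. For d = 0 the only cycle is 0, with Chow form 1. *)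
Definition chow_variety (m d : nat) : set (set {mpoly K[m.+1 * n.+1]}) :=
  [set proj_point G | G in
    [set G : {mpoly K[m.+1 * n.+1]} | multihomogeneous d G /\
      exists Z : cycle, [/\ is_effective_cycle m Z, cycle_has_degree m Z d &
                            is_cycle_chow_form Z G]]].

End ProjectiveVarieties.

(* The points of X with homogeneous coordinates in the subfield of K with Q
   elements, which consists of the roots of X^Q - X when Q is a power of the
   characteristic of the algebraically closed field K. *)
Definition rational_points (K : closedFieldType) (N Q : nat)
    (X : set (set {mpoly K[N]})) : set (set {mpoly K[N]}) :=
  X `&` [set P | exists2 G, P G &
                   forall mu : 'X_{1..N}, G@_mu ^+ Q = G@_mu].
Arguments chow_variety K n m d : clear implicits.

(* Main.v *)
Require Import Defs.
From HB Require Import structures.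
From mathcomp Require Import all_boot all_order all_algebra.
From mathcomp Require Import separable finfield.
From mathcomp Require Import mpoly ring.
From mathcomp Require Import boolp classical_sets functions cardinality.

Set Implicit Arguments.
Unset Strict Implicit.
Unset Printing Implicit Defensive.
Import Order.TTheory GRing.Theory.
Local Open Scope classical_set_scope.
Local Open Scope ring_scope.

(* The unipotent upper triangular group U acts on P^n, hence on the Chow variety,
   and is filtered by one-parameter additive groups normalized by one another.
   When the additive group acts compatibly with the Q-power Frobenius and its
   stabilizers are closed, the rational points of a nontrivial orbit are
   L^-1(H)/H with H the finite stabilizer and L t = t^Q - t, so there are exactly
   Q of them; hence passing to fixed points does not change the number of
   rational points modulo Q.  The support of a U-fixed cycle of dimension m is
   U-invariant, so it is a union of Schubert varieties, which are the linear
   spaces of the standard flag: the only U-fixed point is d times the standard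
   m-plane, whose Chow form is the d-th power of the leading maximal minor.  *)

(** * Polynomials over an algebraically closed field as functions *)

Section PolynomialFunctions.
Variable K : closedFieldType.

(** The cycle behind a fixed point is never reconstructed. Fixedness only yields that its support
    lies in the standard m-plane, so that the Chow form has no zero off the leading minor; rigidity
    then computes the form, since a multihomogeneous polynomial with this property is a constant
    times a power of the minor. Two points cost dimension theory, with dimension defined by chains.
    To see that the support is invariant, a linear space of codimension m+1 must be found through a
    given point off the support and disjoint from all components; this calls for irreducible
    decompositions and hyperplane sections. To see that d times the m-plane is a point of the Chow
    variety at all, the m-plane must have no chain longer than m; this comes from comparing numbers
    of monomials. The root subgroups are taken by decreasing column: a commutator then only involves
    subgroups already known to fix the point. The count runs modulo Q, the order of the field of
    rationality, and a closed stabilizer means one cut out by polynomials in the parameter t. *)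

Lemma poly_eq0_horner (p : {poly K}) : (forall x, p.[x] = 0) -> p = 0.
Proof.
move=> p0; apply/eqP; case: eqVneq => // /closed_nonrootP[x].
by rewrite rootE p0 eqxx.
Qed.

Lemma poly_nonroot (p : {poly K}) : p != 0 -> exists x, p.[x] != 0.
Proof. by move/closed_nonrootP=> [x]; rewrite rootE; exists x. Qed.

(** A nonconstant polynomial has a root. Applied along lines of matrices, this is the source of all
    the rigidity used below. *)
Lemma nonvanishing_poly_const (p : {poly K}) :
  (forall x, p.[x] != 0) -> forall x y, p.[x] = p.[y].
Proof.
move=> p_neq0 x y; have [/eqP/size_poly1P[c _ ->]|] := eqVneq (size p) 1%N.
  by rewrite !hornerC.
by move/closed_rootP=> [z /rootP pz0]; move: (p_neq0 z); rewrite pz0 eqxx.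
Qed.

Lemma exists_expf_neq (a b : nat) : a != b -> exists c : K, c ^+ a != c ^+ b.
Proof.
move=> neq_ab; have: ('X^a - 'X^b : {poly K}) != 0.
  rewrite subr_eq0; apply: contraNneq neq_ab => /(congr1 (fun p : {poly K} => size p)).
  by rewrite !size_polyXn => -[->].
by move/poly_nonroot=> [c]; rewrite !hornerE subr_eq0; exists c.
Qed.

(** Restriction to a parametrized curve, which turns genericity in many variables into avoiding the
    roots of one polynomial. *)
Definition mpoly_subst_poly N (w : 'I_N -> {poly K}) (G : {mpoly K[N]}) :=
  mmap (@polyC K) w G.

Lemma horner_mpoly_subst_poly N (w : 'I_N -> {poly K}) (G : {mpoly K[N]}) t :
  (mpoly_subst_poly w G).[t] = G.@[fun i => (w i).[t]].
Proof.
rewrite /mpoly_subst_poly /meval /mmap horner_sum; apply: eq_bigr => m _.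
rewrite hornerM hornerC /mmap1 horner_prod; congr (_ * _).
by apply: eq_bigr => i _; rewrite horner_exp.
Qed.

Lemma base_expansion_inj N B (a b : 'I_N -> nat) :
  (forall i, a i < B)%N -> (forall i, b i < B)%N ->
  (\sum_(i < N) a i * B ^ i = \sum_(i < N) b i * B ^ i)%N -> a =1 b.
Proof.
elim: N a b => [|N IH] a b aB bB; first by move=> _ [].
rewrite !big_ord_recl /= !expn0 !muln1.
have shift (c : 'I_N.+1 -> nat) :
    (\sum_(i < N) c (lift ord0 i) * B ^ (bump 0 i) =
     (\sum_(i < N) c (lift ord0 i) * B ^ i) * B)%N.
  by rewrite big_distrl /=; apply: eq_bigr => i _; rewrite /bump /= add1n expnSr mulnA.
rewrite !shift => eq_ab.
have B_gt0 : (0 < B)%N by apply: leq_ltn_trans (aB ord0).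
have eq0 : a ord0 = b ord0.
  by move/(congr1 (modn^~ B)): eq_ab; rewrite !(addnC _ (_ * B)%N) !modnMDl !modn_small.
move: eq_ab; rewrite eq0 => /addnI /eqP; rewrite eqn_pmul2r // => /eqP /IH eqS i.
case: (unliftP ord0 i) => [j ->|-> //]; apply: (eqS _ _ j) => k; [exact: aB|exact: bB].
Qed.

(* Kronecker substitution X_i := t^(B^i) reduces to one variable. *)
Lemma mpoly_eq0_meval N (p : {mpoly K[N]}) : (forall v, p.@[v] = 0) -> p = 0.
Proof.
move=> p0; apply/mpolyP => m0; rewrite mcoeff0.
have [m0p|/memN_msupp_eq0//] := boolP (m0 \in msupp p).
(* [msize] exceeds the degree by one, so all exponents in [p] are digits in base [B] and distinct
   monomials receive distinct codes. *)
set B := msize p.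
have mltB m i : m \in msupp p -> (m i < B)%N.
  by move/msize_mdeg_lt; apply: leq_ltn_trans; rewrite mdegE (bigD1 i) //= leq_addr.
pose code (m : 'X_{1..N}) := (\sum_(i < N) m i * B ^ i)%N.
have q0 : mpoly_subst_poly (fun i => 'X^(B ^ i)) p = 0.
  by apply: poly_eq0_horner => t; rewrite horner_mpoly_subst_poly.
have := congr1 (fun q : {poly K} => q`_(code m0)) q0.
rewrite coef0 /mpoly_subst_poly /mmap coef_sum => <-.
rewrite (bigD1_seq m0) ?msupp_uniq //= big1_seq ?addr0.
  rewrite coefCM; suff -> : mmap1 (fun i : 'I_N => 'X^(B ^ i)) m0 = 'X^(code m0) :> {poly K}.
    by rewrite coefXn eqxx mulr1.
  rewrite /mmap1 /code expr_sum; apply: eq_bigr => i _.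
  by rewrite -exprM mulnC.
move=> m /andP[neq_m mp]; rewrite coefCM.
have -> : mmap1 (fun i : 'I_N => 'X^(B ^ i)) m = 'X^(code m) :> {poly K}.
  rewrite /mmap1 /code expr_sum; apply: eq_bigr => i _.
  by rewrite -exprM mulnC.
rewrite coefXn; have [eqc|] := eqVneq (code m0) (code m); last by rewrite mulr0.
case/eqP: neq_m; apply/mnmP; apply: (@base_expansion_inj _ B) => // i; exact: mltB.
Qed.

Lemma eq_mpoly_meval N (p q : {mpoly K[N]}) : (forall v, p.@[v] = q.@[v]) -> p = q.
Proof.
move=> eq_pq; apply/eqP; rewrite -subr_eq0; apply/eqP/mpoly_eq0_meval => v.
by rewrite mevalB eq_pq subrr.
Qed.

Lemma mpoly_nonroot N (p : {mpoly K[N]}) : p != 0 -> exists v, p.@[v] != 0.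
Proof.
move=> p_neq0; apply: contrapT => np; case/eqP: p_neq0; apply: mpoly_eq0_meval => v.
by apply: contrapT => pv; apply: np; exists v; apply/eqP.
Qed.

Lemma meval_mxvec_row a b (G : {mpoly K[a * b]}) (v : 'I_(a * b) -> K) :
  G.@[mxvec (vec_mx (\row_i v i)) 0] = G.@[v].
Proof. by apply: meval_eq => i; rewrite vec_mxK mxE. Qed.

Lemma eq_mpoly_mxvec a b (G H : {mpoly K[a * b]}) :
  (forall u : 'M_(a, b), G.@[mxvec u 0] = H.@[mxvec u 0]) -> G = H.
Proof.
by move=> eqGH; apply: eq_mpoly_meval => v;
  rewrite -meval_mxvec_row eqGH meval_mxvec_row.
Qed.

Lemma mpoly_mxvec_nonroot a b (G : {mpoly K[a * b]}) :
  G != 0 -> exists u : 'M_(a, b), G.@[mxvec u 0] != 0.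
Proof.
move/mpoly_nonroot => [v Gv]; exists (vec_mx (\row_i v i)).
by rewrite meval_mxvec_row.
Qed.

Lemma meval_comp_mktuple N k (G : {mpoly K[N]}) (a : 'I_N -> {mpoly K[k]}) v :
  (G \mPo [tuple a i | i < N]).@[v] = G.@[fun i => (a i).@[v]].
Proof. by rewrite comp_mpoly_meval; apply: meval_eq => i; rewrite tnth_mktuple. Qed.

(** A monomial of weight a is multiplied by c^a, and over an infinite field some c separates c^a
    from c^e. Constant weights 1 give the degree; the indicator of a row gives the degree in one
    hyperplane. *)
Lemma weighted_homogP N (w : 'I_N -> nat) e (f : {mpoly K[N]}) :
  (forall m, m \in msupp f -> (\sum_i w i * m i = e)%N) <->
  (forall c v, f.@[fun i => c ^+ w i * v i] = c ^+ e * f.@[v]).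
Proof.
have evalw c v : f.@[fun i => c ^+ w i * v i] =
    \sum_(m <- msupp f) f@_m * (c ^+ (\sum_i w i * m i)%N * \prod_i v i ^+ m i).
  rewrite mevalE; apply: eq_bigr => m _; congr (_ * _).
  rewrite expr_sum -big_split /=; apply: eq_bigr => i _.
  by rewrite exprMn exprM.
split=> [wf c v|wf m mf].
  rewrite evalw mevalE mulr_sumr; apply: eq_big_seq => m mf.
  by rewrite wf // mulrCA.
apply/eqP; apply: contraT => /exists_expf_neq [c].
pose g := \sum_(m <- msupp f) (f@_m * c ^+ (\sum_i w i * m i)%N) *: 'X_[m].
have : g = c ^+ e *: f.
  apply: eq_mpoly_meval => v; rewrite mevalZ -wf evalw raddf_sum /=.
  by apply: eq_bigr => m' _; rewrite mevalZ mevalX mulrA.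
move/(congr1 (mcoeff m)); rewrite mcoeffZ raddf_sum /= (bigD1_seq m) ?msupp_uniq //=.
rewrite [X in _ + X]big1 ?addr0 => [|m' /negPf neq]; rewrite mcoeffZ mcoeffX.
  rewrite eqxx mulr1 mulrC => /eqP; rewrite (inj_eq (mulIf _)) -?mcoeff_msupp //.
  by move/eqP->; rewrite eqxx.
by rewrite neq mulr0.
Qed.

Lemma dhomog_mevalP N e (f : {mpoly K[N]}) :
  f \is e.-homog <-> (forall c v, f.@[fun i => c * v i] = c ^+ e * f.@[v]).
Proof.
have sum1 (m : 'X_{1..N}) : (\sum_i 1 * m i)%N = mdeg m.
  by rewrite mdegE; apply: eq_bigr => i _; rewrite mul1n.
have [H1 H2] := weighted_homogP (fun=> 1%N) e f.
split=> [/dhomogP fh|fh]; first by move: H1; apply=> m /fh <-.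
by apply/dhomogP => m mf; rewrite -(H2 _ m mf) ?sum1.
Qed.

Lemma big_mxvec_index (R : Type) (idx : R) (op : Monoid.com_law idx) a b
    (F : 'I_(a * b) -> R) :
  \big[op/idx]_k F k = \big[op/idx]_(i < a) \big[op/idx]_(j < b) F (mxvec_index i j).
Proof. by rewrite pair_bigA /= (reindex _ (curry_mxvec_bij _ _)) /=; apply: eq_bigr => -[]. Qed.

End PolynomialFunctions.

(** * Linear changes of coordinates on forms, closed sets and cycles *)

Lemma proper_neqP T (A B : set T) : A `<` B <-> A <> B /\ A `<=` B.
Proof. by rewrite properEneq; split=> -[/eqP neq sAB]; split=> //; apply/eqP. Qed.

(** The form u |-> G(u M). Multiplying on the right makes this a left action, and if [G] is the Chow
    form of V then [act M G] is that of the image M V. *)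
HB.lock Definition act (K : closedFieldType) a b (M : 'M[K]_b)
    (G : {mpoly K[a * b]}) : {mpoly K[a * b]} :=
  G \mPo [tuple mxvec (vec_mx (\row_k 'X_k) *m map_mx (@mpolyC _ K) M) 0 k
         | k < (a * b)%N].

Section LinearAction.
Variable K : closedFieldType.

Definition subst_cols n (M : 'M[K]_n) (f : {mpoly K[n]}) : {mpoly K[n]} :=
  f \mPo [tuple \sum_l M i l *: 'X_l | i < n].

Lemma meval_subst_cols n (M : 'M[K]_n) f (x : 'cV[K]_n) :
  (subst_cols M f).@[fun i => x i 0] = f.@[fun i => (M *m x) i 0].
Proof.
rewrite meval_comp_mktuple; apply: meval_eq => i; rewrite mxE raddf_sum /=.
by apply: eq_bigr => l _; rewrite mevalZ mevalXU.
Qed.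

Lemma meval_cV n (f : {mpoly K[n]}) (v : 'I_n -> K) :
  f.@[fun i => (\col_i v i) i 0] = f.@[v].
Proof. by apply: meval_eq => i; rewrite mxE. Qed.

Lemma dhomog_cVP n e (f : {mpoly K[n]}) :
  f \is e.-homog <-> (forall c (x : 'cV[K]_n),
    f.@[fun i => (c *: x) i 0] = c ^+ e * f.@[fun i => x i 0]).
Proof.
rewrite dhomog_mevalP; split=> fh c x.
  by rewrite -fh; apply: meval_eq => i; rewrite mxE.
by rewrite -(meval_cV f x) -fh; apply: meval_eq => i; rewrite !mxE.
Qed.

Lemma dhomog_subst_cols n e (M : 'M[K]_n) f :
  f \is e.-homog -> subst_cols M f \is e.-homog.
Proof.
move/dhomog_cVP => fh; apply/dhomog_cVP => c x.
by rewrite !meval_subst_cols -scalemxAr fh.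
Qed.

Lemma meval_act a b (M : 'M[K]_b) (G : {mpoly K[a * b]}) (u : 'M[K]_(a, b)) :
  (act M G).@[mxvec u 0] = G.@[mxvec (u *m M) 0].
Proof.
rewrite unlock meval_comp_mktuple; apply: meval_eq => k.
transitivity ((map_mx (meval (mxvec u 0))
   (mxvec (vec_mx (\row_k 'X_k) *m map_mx (@mpolyC _ K) M))) 0 k).
  by rewrite [RHS]mxE.
rewrite map_mxvec map_mxM map_vec_mx; congr (mxvec (_ *m _) 0 k).
  rewrite -[RHS]mxvecK; congr vec_mx; apply/rowP => j; rewrite !mxE. exact: mevalXU.
by apply/matrixP => i j; rewrite !mxE; exact: mevalC.
Qed.

Section ActionTheory.
Variables a b : nat.
Implicit Types (M N : 'M[K]_b) (G H : {mpoly K[a * b]}).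

Lemma act1 G : act 1%:M G = G.
Proof. by apply: eq_mpoly_mxvec => u; rewrite meval_act mulmx1. Qed.

Lemma actA M N G : act M (act N G) = act (M *m N) G.
Proof. by apply: eq_mpoly_mxvec => u; rewrite !meval_act mulmxA. Qed.

Lemma actK M : M \in unitmx -> cancel (@act K a b M) (act (invmx M)).
Proof. by move=> uM G; rewrite actA mulVmx // act1. Qed.

Lemma actZ M c G : act M (c *: G) = c *: act M G.
Proof. by rewrite unlock; apply: comp_mpolyZ. Qed.

Lemma actM M G H : act M (G * H) = act M G * act M H.
Proof. by rewrite unlock; apply: rmorphM. Qed.

Lemma act_prod M I (r : seq I) (F : I -> {mpoly K[a * b]}) (k : I -> nat) :
  act M (\prod_(i <- r) F i ^+ k i) = \prod_(i <- r) act M (F i) ^+ k i.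
Proof.
rewrite unlock rmorph_prod; apply: eq_bigr => i _; exact: rmorphXn.
Qed.

Lemma act_unit M G : G \is a GRing.unit -> act M G \is a GRing.unit.
Proof. by rewrite unlock; apply: rmorph_unit. Qed.

Lemma act_unitE M G : M \in unitmx ->
  (act M G \is a GRing.unit) = (G \is a GRing.unit).
Proof.
move=> uM; apply/idP/idP => [|/act_unit//].
by move/(act_unit (invmx M)); rewrite actK.
Qed.

Lemma irreducible_act M G :
  M \in unitmx -> irreducible_mpoly G -> irreducible_mpoly (act M G).
Proof.
move=> uM [nuG irrG]; split=> [|A B]; first by rewrite act_unitE.
move/(congr1 (act (invmx M))); rewrite actK // actM => /irrG.
by rewrite !act_unitE ?unitmx_inv.
Qed.

Lemma act_neq0 M G : M \in unitmx -> G != 0 -> act M G != 0.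
Proof.
move=> uM; apply: contraNneq => /(congr1 (act (invmx M))); rewrite actK // => ->.
by rewrite unlock rmorph0.
Qed.

End ActionTheory.

Variable n : nat.
Implicit Types (V A B : set 'cV[K]_n.+1) (N : 'M[K]_n.+1).

(** Translates are encoded as preimages, so that membership needs no witness; the image of [V] under
    an invertible M is [lpre (invmx M) V]. *)
Definition lpre N V : set 'cV[K]_n.+1 := [set x | V (N *m x)].

Lemma lpreK N V : N \in unitmx -> lpre N (lpre (invmx N) V) = V.
Proof. by move=> uN; rewrite /lpre; apply/seteqP; split=> x /=; rewrite mulKmx. Qed.

Lemma lpreVK N V : N \in unitmx -> lpre (invmx N) (lpre N V) = V.
Proof. by move=> uN; rewrite /lpre; apply/seteqP; split=> x /=; rewrite mulKVmx. Qed.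

Lemma sub_lpre N A B : A `<=` B -> lpre N A `<=` lpre N B.
Proof. by move=> sAB x; apply: sAB. Qed.

(* In [zero_locus] the condition [x != 0] is elaborated on the function
   underlying the column [x]. *)
Lemma zero_locusP (S : set {mpoly K[n.+1]}) (x : 'cV[K]_n.+1) :
  zero_locus S x <-> x != 0 /\ forall f, S f -> f.@[fun i => x i 0] = 0.
Proof.
have fun0 : (fun_of_matrix x != 0) = (x != 0).
  congr negb; apply/eqP/eqP => [x0|->]; last by apply/funext => i; apply/funext => j; rewrite mxE.
  by apply/matrixP => i j; rewrite mxE x0.
by split=> -[x0 Sx]; split=> //; move: x0; rewrite /= fun0.
Qed.

Lemma proj_closed_lpre N V : N \in unitmx -> proj_closed V -> proj_closed (lpre N V).
Proof.
move=> uN [S hS ->]; exists (subst_cols N @` S).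
  by move=> _ [f /hS[e fe] <-]; exists e; apply: dhomog_subst_cols.
apply/seteqP; split=> x /zero_locusP[x0 Sx]; apply/zero_locusP; split.
- by apply: contra_neq x0 => ->; rewrite mulmx0.
- by move=> _ [f /Sx fx <-]; rewrite meval_subst_cols.
- by apply: contra_neq x0 => Nx0; rewrite -(mulKmx uN x) Nx0 mulmx0.
- by move=> f Sf; rewrite -meval_subst_cols; apply: Sx; exists f.
Qed.

Lemma irreducible_closed_lpre N V :
  N \in unitmx -> irreducible_closed V -> irreducible_closed (lpre N V).
Proof.
move=> uN [cV [x Vx] irrV]; split; first exact: proj_closed_lpre.
  by exists (invmx N *m x); rewrite /lpre /= mulKVmx.
move=> A B cA cB sV.
have uNV : invmx N \in unitmx by rewrite unitmx_inv.
have: V `<=` lpre (invmx N) A `|` lpre (invmx N) B.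
  by rewrite -[X in X `<=` _](lpreVK _ uN) => z; apply: sV.
case/irrV; try exact: proj_closed_lpre.
  by move/(@sub_lpre N); rewrite lpreK //; left.
by move/(@sub_lpre N); rewrite lpreK //; right.
Qed.

Lemma chain_lpre N V k : N \in unitmx ->
  has_irreducible_chain V k -> has_irreducible_chain (lpre N V) k.
Proof.
move=> uN [Z [irrZ ltZ]]; exists (fun i => lpre N (Z i)); split=> i ik.
  by have [iZ sZ] := irrZ i ik; split; [exact: irreducible_closed_lpre|exact: sub_lpre].
have /proper_neqP [neqZ sZ] := ltZ i ik; apply/proper_neqP; split; last exact: sub_lpre.
by move=> /(congr1 (lpre (invmx N))); rewrite !lpreVK.
Qed.

Lemma has_dim_lpre N V k : N \in unitmx -> has_dim V k -> has_dim (lpre N V) k.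
Proof.
move=> uN [cV ncV]; split; first exact: chain_lpre.
by move/(@chain_lpre (invmx N)); rewrite lpreVK // unitmx_inv => /(_ uN).
Qed.

Lemma linear_section_lpre k N V (u : 'M[K]_(k, n.+1)) : N \in unitmx ->
  linear_section (lpre N V) u = lpre N (linear_section V (u *m invmx N)).
Proof.
move=> uN; apply/seteqP; split=> x [Vx /= ux]; split=> //=.
  by rewrite -mulmxA mulKmx.
by move: ux; rewrite /= -mulmxA mulKmx.
Qed.

Lemma has_degree_lpre m N V e :
  N \in unitmx -> has_degree m V e -> has_degree m (lpre N V) e.
Proof.
move=> uN [D D0 degV]; exists (act (invmx N) D).
  by apply: act_neq0 => //; rewrite unitmx_inv.
move=> u; rewrite meval_act => /degV; rewrite linear_section_lpre //.
set A := linear_section _ _; apply: card_eq_trans.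
have -> : proj_point (W:='cV[K]_n.+1) @` lpre N A =
          (fun P => lpre N P) @` (proj_point (W:='cV[K]_n.+1) @` A).
  have proj_lpre x : proj_point (x : 'cV[K]_n.+1) = lpre N (proj_point (N *m x)).
    apply/seteqP; split=> y /= [c c0] cNy.
      by exists c => //; rewrite -cNy scalemxAr.
    exists c => //.
    by rewrite -(mulKmx uN y) -cNy -scalemxAr mulKmx.
  apply/seteqP; split=> P.
    by move=> [x Ax <-]; exists (proj_point (N *m x)); [exists (N *m x)|rewrite -proj_lpre].
  move=> [_ [x Ax <-] <-]; exists (invmx N *m x).
    by rewrite /lpre /= mulKVmx.
  by rewrite proj_lpre mulKVmx.
apply: inj_card_eq => P Q _ _ /(congr1 (fun P => lpre (invmx N) P)).
by rewrite !lpreVK.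
Qed.

Lemma is_chow_form_lpre m N V (G : {mpoly K[m.+1 * n.+1]}) :
  N \in unitmx -> is_chow_form V G -> is_chow_form (lpre N V) (act (invmx N) G).
Proof.
move=> uN [irrG GV]; split; first by apply: irreducible_act => //; rewrite unitmx_inv.
move=> u; rewrite meval_act GV linear_section_lpre //; split=> [[x Vx]|[x Vx]].
  by exists (invmx N *m x); rewrite /lpre /= mulKVmx.
by exists (N *m x).
Qed.

Lemma sum_row_weight m (mu : 'X_{1..m.+1 * n.+1}) (i : 'I_m.+1) :
  (\sum_k mxvec (\matrix_(i' < m.+1, j < n.+1) (i' == i : nat)) ord0 k * mu k =
   \sum_(j < n.+1) mu (mxvec_index i j))%N.
Proof.
rewrite big_mxvec_index (bigD1 i) //= [X in (_ + X)%N]big1 ?addn0.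
  by apply: eq_bigr => j _; rewrite mxvecE mxE eqxx mul1n.
move=> i' /negPf neq; apply: big1 => j _.
by rewrite mxvecE mxE neq mul0n.
Qed.

Definition scale_row m (i : 'I_m) c (u : 'M[K]_(m, n.+1)) : 'M[K]_(m, n.+1) :=
  \matrix_(i', j) (c ^+ (i' == i) * u i' j).

Lemma mul_scale_row m (i : 'I_m) c (u : 'M[K]_(m, n.+1)) N :
  scale_row i c u *m N = scale_row i c (u *m N).
Proof.
apply/matrixP => i' j; rewrite !mxE mulr_sumr; apply: eq_bigr => l _.
by rewrite !mxE mulrA.
Qed.

(** In this functional form, multihomogeneity visibly survives right multiplication of [u], which
    commutes with scaling a row. *)
Lemma multihomogeneousP m d (G : {mpoly K[m.+1 * n.+1]}) :
  multihomogeneous d G <-> forall i c u,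
    G.@[mxvec (scale_row i c u) 0] = c ^+ d * G.@[mxvec u 0].
Proof.
pose w (i : 'I_m.+1) := fun k => mxvec (\matrix_(i' < m.+1, j < n.+1) (i' == i : nat)) ord0 k.
have evalw i c u : G.@[mxvec (scale_row i c u) 0] = G.@[fun k => c ^+ w i k * mxvec u 0 k].
  by apply: meval_eq => k; case/mxvec_indexP: k => i' j; rewrite /w !mxvecE !mxE.
split=> [hG i c u|hG mu muG i].
  rewrite evalw; move: c (mxvec u 0); apply/(weighted_homogP (w i)) => mu muG.
  by rewrite /w sum_row_weight hG.
rewrite -sum_row_weight; move: mu muG; apply/(weighted_homogP (w i)) => c v.
have := hG i c (vec_mx (\row_k v k)); rewrite evalw meval_mxvec_row => <-.
by apply: meval_eq => k; rewrite vec_mxK mxE.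
Qed.

Lemma multihomogeneous_act m d N (G : {mpoly K[m.+1 * n.+1]}) :
  multihomogeneous d G -> multihomogeneous d (act N G).
Proof.
move/multihomogeneousP => hG; apply/multihomogeneousP => i c u.
by rewrite !meval_act mul_scale_row hG.
Qed.

Definition chow_cycle m d (G : {mpoly K[m.+1 * n.+1]}) : Prop :=
  multihomogeneous d G /\ exists Z : Defs.cycle K n,
    [/\ is_effective_cycle m Z, cycle_has_degree m Z d & is_cycle_chow_form Z G].

Lemma chow_cycle_act m d M (G : {mpoly K[m.+1 * n.+1]}) :
  M \in unitmx -> chow_cycle d G -> chow_cycle d (act M G).
Proof.
move=> uM [hG [Z [effZ [e degZ dE] [g gZ GE]]]].
have uMV : invmx M \in unitmx by rewrite unitmx_inv.
split; first exact: multihomogeneous_act.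
exists (Cycle (fun i => lpre (invmx M) (Defs.comp i)) (@mult _ _ Z)); split=> /=.
- move=> i; have [irr dim] := effZ i.
  by split; [exact: irreducible_closed_lpre|exact: has_dim_lpre].
- by exists e => // i; apply: has_degree_lpre.
exists (fun i => act M (g i)) => /= [i|]; last by rewrite GE act_prod.
by have := is_chow_form_lpre uMV (gZ i); rewrite invmxK.
Qed.

End LinearAction.

(** * Dickson's lemma *)

Section Noetherian.
Local Open Scope nat_scope.

(** Every tail attains its minimum; one jumps repeatedly to an index where the tail beyond the
    previous one is minimal. *)
Lemma nondecreasing_subsequence (a : nat -> nat) : exists phi : nat -> nat,
  (forall i j, i < j -> phi i < phi j) /\ (forall i j, i <= j -> a (phi i) <= a (phi j)).
Proof.
have /choice[mn mnP] i : exists j, i <= j /\ forall k, j <= k -> a j <= a k.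
  have ex : exists v, `[< exists2 j, i <= j & a j = v >].
    by exists (a i); apply/asboolP; exists i.
  case: (ex_minnP ex) => v /asboolP[j ij <-] jmin; exists j; split=> // k jk.
  by apply: jmin; apply/asboolP; exists k => //; apply: leq_trans jk.
pose phi := fix phi k := if k is k'.+1 then mn (phi k').+1 else mn 0.
have phiS k : phi k < phi k.+1 by case: (mnP (phi k).+1).
have phi_min k l : phi k <= l -> a (phi k) <= a l.
  by case: k => [|k] /=; [case: (mnP 0) => _|case: (mnP (phi k).+1) => _]; apply.
have phi_lt i j : i < j -> phi i < phi j.
  elim: j => // j IH; rewrite ltnS leq_eqVlt => /orP[/eqP->//|/IH].
  by move/ltn_trans; apply.
exists phi; split=> // i j; rewrite leq_eqVlt => /orP[/eqP->//|/phi_lt ij].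
exact/phi_min/ltnW.
Qed.

(** Subsequences are extracted for one coordinate after another; coordinates already monotone stay
    so. *)
Lemma dickson n (s : nat -> 'X_{1..n}) : exists i j, i < j /\ (s i <= s j)%MM.
Proof.
have sub k : k <= n -> exists phi : nat -> nat,
    (forall i j, i < j -> phi i < phi j) /\
    (forall c : 'I_n, c < k -> forall i j, i <= j -> s (phi i) c <= s (phi j) c).
  elim: k => [|k IH] kn; first by exists id.
  have [phi [phi_lt phiP]] := IH (ltnW kn).
  have [psi [psi_lt psiP]] :=
    nondecreasing_subsequence (fun i => s (phi i) (Ordinal kn)).
  have psi_le i j : i <= j -> psi i <= psi j.
    by rewrite leq_eqVlt => /orP[/eqP->//|/psi_lt/ltnW].
  exists (phi \o psi); split=> [i j ij|c]; first exact/phi_lt/psi_lt.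
  rewrite ltnS leq_eqVlt => /orP[/eqP ck|ck] i j ij /=.
    by have -> : c = Ordinal kn; [exact: val_inj|exact: psiP].
  exact/phiP/psi_le.
have [phi [phi_lt phiP]] := sub n (leqnn n).
exists (phi 0), (phi 1); split; first exact: phi_lt.
by apply/mnm_lepP => c; apply: phiP.
Qed.

End Noetherian.

(** * Closed sets: descending chains, components, hyperplane sections *)

Section ClosedSets.
Variables (K : closedFieldType) (n : nat).
Implicit Types (V A B Z : set 'cV[K]_n.+1) (f g : {mpoly K[n.+1]}).

Definition vanishes_on V f := forall x, V x -> f.@[fun i => x i 0] = 0.

Lemma proj_closed_sep V x : proj_closed V -> x != 0 -> ~ V x ->
  exists f, [/\ exists e : nat, f \is e.-homog, vanishes_on V f & f.@[fun i => x i 0] != 0].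
Proof.
move=> [S hS ->] x0 nVx; apply: contrapT => nf; apply: nVx; apply/zero_locusP; split=> // f Sf.
apply: contrapT => /eqP fx; apply: nf; exists f; split=> //; first exact: hS.
by move=> y /zero_locusP[_]; apply.
Qed.

Lemma proj_closed_neq0 V x : proj_closed V -> V x -> x != 0.
Proof. by move=> [S _ ->] /zero_locusP[]. Qed.

Lemma proj_closedZ V x c : proj_closed V -> c != 0 -> V x -> V (c *: x).
Proof.
move=> [S hS ->] c0 /zero_locusP[x0 Sx]; apply/zero_locusP; split=> [|f Sf].
  by rewrite scaler_eq0 negb_or c0.
have [e /dhomog_cVP ->] := hS f Sf.
by rewrite Sx // mulr0.
Qed.

Lemma proj_closedI A B : proj_closed A -> proj_closed B -> proj_closed (A `&` B).
Proof.
move=> [S hS ->] [T hT ->]; exists (S `|` T).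
  by move=> f [/hS|/hT].
apply/seteqP; split=> x.
  by move=> [/zero_locusP[x0 Sx] /zero_locusP[_ Tx]]; apply/zero_locusP; split=> // f [/Sx|/Tx].
move=> /zero_locusP[x0 STx].
by split; apply/zero_locusP; split=> // f Sf; apply: STx; [left|right].
Qed.

Definition hyperplane (l : 'rV[K]_n.+1) : set 'cV[K]_n.+1 :=
  [set x | x != 0 /\ l *m x = 0].

Lemma proj_closed_hyperplane l : proj_closed (hyperplane l).
Proof.
pose f := \sum_j l 0 j *: 'X_j : {mpoly K[n.+1]}.
have fE (x : 'cV[K]_n.+1) : f.@[fun i => x i 0] = (l *m x) 0 0.
  rewrite mxE raddf_sum; apply: eq_bigr => j _ /=.
  by rewrite mevalZ mevalXU.
exists [set f].
  move=> _ ->; exists 1%N; apply/dhomog_cVP => c x.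
  by rewrite !fE -scalemxAr mxE expr1.
apply/seteqP; split=> x.
  by move=> [x0 lx]; apply/zero_locusP; split=> // _ ->; rewrite fE lx mxE.
move=> /zero_locusP[x0 lx]; split=> //.
by apply/matrixP => i j; rewrite !ord1 -fE lx // mxE.
Qed.

Lemma vanishing_minimal_lead Z Z' : proj_closed Z' -> Z' `<` Z ->
  (forall x, Z x -> x != 0) ->
  exists f, [/\ vanishes_on Z' f, ~ vanishes_on Z f &
    forall g, vanishes_on Z' g -> ~ vanishes_on Z g -> (mlead f <= mlead g)%O].
Proof.
move=> cZ' ltZ Z0; pose P m := exists f, [/\ vanishes_on Z' f, ~ vanishes_on Z f & mlead f = m].
have [m Pm] : exists m, P m.
  have [x [Zx nZ'x]] : exists x, Z x /\ ~ Z' x.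
    apply: contrapT => nx; move: ltZ => /proper_neqP[neq sZ]; apply: neq.
    apply/seteqP; split=> // x Zx; apply: contrapT => nZx.
    by apply: nx; exists x.
  have [f [_ fZ' fx]] := proj_closed_sep cZ' (Z0 x Zx) nZ'x.
  exists (mlead f), f; split=> // fZ.
  by move: fx; rewrite fZ // eqxx.
have [m' [f [fZ' fZ <-]] m'min] : exists2 m', P m' & forall m'', P m'' -> (m' <= m'')%O.
  elim/(well_founded_induction (@ltom_wf n.+1)): m Pm => m IH Pm.
  have [[m' [Pm' ltm]]|nm] := pselect (exists m', P m' /\ (m' < m)%O).
    exact: IH Pm'.
  exists m => // m'' Pm''; rewrite leNgt; apply/negP => ltm.
  by apply: nm; exists m''.
exists f; split=> // g gZ' gZ; apply: m'min.
by exists g.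
Qed.

(* With f_i of minimal leading monomial among the forms separating Z_{i+1} from
   Z_i, Dickson's lemma gives i < j such that f_j can be reduced by f_i. *)
Lemma closed_dcc (Z : nat -> set 'cV[K]_n.+1) :
  (forall i, proj_closed (Z i)) -> ~ (forall i, Z i.+1 `<` Z i).
Proof.
move=> cZ ltZ.
have Zneq0 i x : Z i x -> x != 0 by apply: proj_closed_neq0.
have /choice[f fP] i := vanishing_minimal_lead (cZ i.+1) (ltZ i) (@Zneq0 i).
have Z_sub i j : (i <= j)%N -> Z j `<=` Z i.
  elim: j => [|j IH]; first by rewrite leqn0 => /eqP->.
  rewrite leq_eqVlt => /orP[/eqP->//|/IH sZ].
  by apply: subset_trans sZ; have /proper_neqP[] := ltZ j.
have [i [j [ij le_ij]]] := dickson (fun i => mlead (f i)).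
have [fi fi' _] := fP i; have [fj fj' minj] := fP j.
have fneq0 k : f k != 0.
  have [_ fk _] := fP k; apply/eqP => fk0; apply: fk => x _.
  by rewrite fk0 meval0.
pose q := (mleadc (f j) / mleadc (f i)) *: 'X_[mlead (f j) - mlead (f i)] : {mpoly K[n.+1]}.
have lcf k : mleadc (f k) != 0 by rewrite mleadc_eq0.
have q0 : q != 0.
  apply/eqP => /(congr1 (mcoeff (mlead (f j) - mlead (f i)))).
  rewrite mcoeffZ mcoeffX eqxx mulr1 mcoeff0 => /eqP.
  by rewrite mulf_eq0 invr_eq0 !(negPf (lcf _)).
have leadq : mlead (q * f i) = mlead (f j).
  rewrite mleadM // /q mleadZ ?mleadXm ?submK //.
  by rewrite mulf_eq0 invr_eq0 !(negPf (lcf _)).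
have lcq : (q * f i)@_(mlead (f j)) = mleadc (f j).
  transitivity (mleadc (q * f i)); first by rewrite leadq.
  rewrite mleadM // mleadcM /q mleadZ ?mleadXm; last first.
    by rewrite mulf_eq0 invr_eq0 !(negPf (lcf _)).
  by rewrite mcoeffZ mcoeffX eqxx mulr1 divfK.
(* Since i < j, [f i] vanishes on [Z j], so [g] separates [Z j] from [Z j.+1] just as [f j] does.
   Its leading term has cancelled, against minimality. *)
pose g := f j - q * f i.
have gj1 : vanishes_on (Z j.+1) g.
  move=> x Zx; rewrite mevalB mevalM fj // fi ?mulr0 ?subrr //.
  by apply: Z_sub Zx; apply: ltnW.
have gj : ~ vanishes_on (Z j) g.
  move=> gj; apply: fj' => x Zx; move: (gj x Zx); rewrite mevalB mevalM.
  by rewrite (fi x) ?mulr0 ?subr0 //; apply: Z_sub Zx.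
have := minj g gj1 gj; rewrite le_eqVlt => /orP[/eqP eq_lead|]; last first.
  apply/negP; rewrite -leNgt; apply: le_trans (mleadB_le _ _) _.
  by rewrite leadq joinxx.
apply: gj => x _; suff -> : g = 0 by rewrite meval0.
by apply/eqP; rewrite -mleadc_eq0 -eq_lead mcoeffB lcq subrr.
Qed.

(** Noetherian induction: a closed set without decomposition is neither empty nor irreducible, so it
    is covered by two smaller closed subsets, one of which is again bad. Iterating the choice
    contradicts [closed_dcc]. *)
Lemma closed_decomposition V : proj_closed V ->
  exists2 s : seq (set 'cV[K]_n.+1), {in s, forall Z, irreducible_closed Z} &
    V = [set x | exists2 Z, Z \in s & Z x].
Proof.
pose dec V := exists2 s : seq (set 'cV[K]_n.+1), {in s, forall Z, irreducible_closed Z} &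
    V = [set x | exists2 Z, Z \in s & Z x].
move=> cV; apply: contrapT => ndV.
pose bad V := proj_closed V /\ ~ dec V.
have step V' : exists V'', bad V' -> bad V'' /\ V'' `<` V'.
  have [badV'|] := pselect (bad V'); last by exists V'.
  have [cV' ndV'] := badV'; apply: contrapT => nV''.
  have small V'' : proj_closed V'' -> V'' `<` V' -> dec V''.
    move=> cV'' ltV''; apply: contrapT => nd.
    by apply: nV''; exists V''.
  apply: ndV'; have [V'0|V'neq0] := pselect (V' = set0).
    exists [::] => //; rewrite V'0; apply/seteqP; split=> x //.
    by case.
  apply: contrapT => ndV'; apply: ndV'; exists [:: V'].
    move=> Y; rewrite mem_seq1 => /eqP ->; split=> //; first exact/set0P/eqP.
    move=> A B cA cB sAB; apply: contrapT => nAB.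
    have decI C : proj_closed C -> ~ (V' `<=` C) -> dec (V' `&` C).
      move=> cC nsC; apply: small; first exact: proj_closedI.
      apply/proper_neqP; split; last exact: subIsetl.
      by move=> eqV; apply: nsC; rewrite -eqV; exact: subIsetr.
    have [|s irs sE] := decI A cA; first by move=> sA; apply: nAB; left.
    have [|t irt tE] := decI B cB; first by move=> sB; apply: nAB; right.
    case: badV' => _; apply; exists (s ++ t).
      by move=> Z; rewrite mem_cat => /orP[/irs|/irt].
    apply/seteqP; split=> x.
      move=> V'x; case: (sAB x V'x) => ABx.
        have : (V' `&` A) x by [].
        by rewrite sE => -[Z Zs Zx]; exists Z => //; rewrite mem_cat Zs.
      have : (V' `&` B) x by [].
      by rewrite tE => -[Z Zs Zx]; exists Z => //; rewrite mem_cat Zs orbT.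
    move=> [Z]; rewrite mem_cat => /orP[Zs|Zt] Zx.
      have : (V' `&` A) x by rewrite sE; exists Z.
      by case.
    have : (V' `&` B) x by rewrite tE; exists Z.
    by case.
  apply/seteqP; split=> x; first by exists V'; rewrite ?mem_seq1.
  by move=> [Z]; rewrite mem_seq1 => /eqP ->.
have [F FP] := choice step.
have badF i : bad (iter i F V) by elim: i => //= i /FP[].
apply: (@closed_dcc (fun i => iter i F V)) => i; first by case: (badF i).
by case: (FP _ (badF i)).
Qed.

(** For one vector w, the forms y_a X_b - y_b X_a vanish at y, and they all vanish at w only if w is
    a multiple of y. Several vectors are handled by a general member of a pencil. *)
Lemma exists_hyperplane_avoiding (y : 'cV[K]_n.+1) (s : seq 'cV[K]_n.+1) :
  y != 0 -> {in s, forall w, forall c, w <> c *: y} ->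
  exists2 l : 'rV[K]_n.+1, l *m y = 0 & {in s, forall w, l *m w != 0}.
Proof.
move=> y0; have single w : (forall c, w <> c *: y) ->
    exists2 l : 'rV[K]_n.+1, l *m y = 0 & l *m w != 0.
  move=> nw; apply: contrapT => nl.
  have [a ya] : exists a, y a 0 != 0.
    apply: contrapT => na; case/eqP: y0; apply/colP => a; rewrite mxE.
    by apply: contrapT => /eqP ya; apply: na; exists a.
  apply: (nw (w a 0 / y a 0)); apply/colP => b; rewrite mxE.
  pose l : 'rV[K]_n.+1 := y a 0 *: delta_mx 0 b - y b 0 *: delta_mx 0 a.
  have lE (z : 'cV[K]_n.+1) : l *m z = (y a 0 * z b 0 - y b 0 * z a 0)%:M.
    rewrite mulmxBl -!scalemxAl -!rowE.
    by apply/matrixP => i j; rewrite !ord1 !mxE eqxx mulr1n.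
  apply: contrapT => nwb; apply: nl; exists l; rewrite lE.
    by rewrite mulrC subrr; apply/matrixP => i j; rewrite !mxE mul0rn.
  apply/eqP => /matrixP/(_ 0 0); rewrite !mxE eqxx mulr1n => /eqP.
  rewrite subr_eq0 => /eqP eqw; apply: nwb.
  by rewrite mulrAC [w a 0 * _]mulrC -eqw mulrAC divff // mul1r.
elim: s => [|w s IH] ns; first by exists 0 => //; rewrite mul0mx.
have [|l ly ls] := IH; first by move=> z zs; apply: ns; rewrite inE zs orbT.
have [|l' l'y l'w] := single w; first by apply: ns; rewrite inE eqxx.
(* The value at [z] of [l + t *: l']. Its constant term is nonzero for [z] in [s] and its slope is
   nonzero for [z = w], so a common [t] exists. *)
pose p (z : 'cV[K]_n.+1) := ((l *m z) 0 0)%:P + ((l' *m z) 0 0)%:P * 'X : {poly K}.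
have pE t z : (p z).[t] = ((l + t *: l') *m z) 0 0.
  by rewrite !hornerE mulmxDl -scalemxAl !mxE mulrC.
have scal0 (M : 'M[K]_1) : M 0 0 = 0 -> M = 0.
  by move=> M0; apply/matrixP => i j; rewrite !ord1 M0 mxE.
have p0 z : z \in w :: s -> p z != 0.
  rewrite inE => /orP[/eqP->|zs].
    apply: contra_neq l'w => /(congr1 (fun q : {poly K} => q`_1)).
    by rewrite coefD coefC coefMX coefC coef0 add0r => /scal0.
  apply: contra_neq (ls z zs) => /(congr1 (fun q : {poly K} => q`_0)).
  by rewrite coefD coefC coefMX coef0 addr0 => /scal0.
have : \prod_(z <- w :: s) p z != 0.
  by rewrite prodf_seq_neq0; apply/allP => z /p0.
move/poly_nonroot => [t]; rewrite horner_prod prodf_seq_neq0 => /allP pt.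
exists (l + t *: l'); first by rewrite mulmxDl -scalemxAl ly l'y scaler0 addr0.
move=> z /pt /=; rewrite pE; apply: contra_neq => ->; by rewrite mxE.
Qed.

(* Cutting by a hyperplane through y which contains no component lowers the
   dimension by one. *)
Lemma linear_space_avoiding k (s : seq (set 'cV[K]_n.+1)) (y : 'cV[K]_n.+1) :
  y != 0 ->
  {in s, forall Z, irreducible_closed Z /\ ~ has_irreducible_chain Z k} ->
  {in s, forall Z, ~ Z y} ->
  exists2 u : 'M[K]_(k, n.+1), u *m y = 0 &
    {in s, forall Z x, Z x -> u *m x != 0}.
Proof.
move=> y0; elim: k s => [|k IH] s irs nsy.
  (* An irreducible set always carries a chain of length 0, so [s] has no element here. *)
  exists 0; first by rewrite mul0mx.
  move=> Z /irs [irZ] nc; case: nc.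
  by exists (fun=> Z); split=> i //; split.
have [pt ptP] : exists pt : set 'cV[K]_n.+1 -> 'cV[K]_n.+1, {in s, forall Z, Z (pt Z)}.
  have /choice[pt ptP] (Z : set 'cV[K]_n.+1) : exists x, Z \in s -> Z x.
    have [/irs [[_ [x Zx] _] _]|] := boolP (Z \in s); first by exists x.
    by exists 0.
  by exists pt => Z /ptP.
have [|l ly ls] := @exists_hyperplane_avoiding y (map pt s) y0.
  move=> _ /mapP[Z Zs ->] c eqw.
  have [[cZ _ _] _] := irs Z Zs.
  have c0 : c != 0.
    apply/eqP => c0; have := proj_closed_neq0 cZ (ptP Z Zs).
    by rewrite eqw c0 scale0r eqxx.
  apply: (nsy Z Zs); rewrite -[y](scalerK c0) -eqw.
  by apply: proj_closedZ; rewrite ?invr_eq0 //; apply: ptP.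
have /choice[dec decP] (Z : set 'cV[K]_n.+1) : exists t : seq (set 'cV[K]_n.+1),
    Z \in s -> {in t, forall Z', irreducible_closed Z'} /\
      Z `&` hyperplane l = [set x | exists2 Z', Z' \in t & Z' x].
  have [/irs [[cZ _ _] _]|] := boolP (Z \in s); last by exists [::].
  have [t irt tE] := closed_decomposition (proj_closedI cZ (proj_closed_hyperplane l)).
  by exists t.
have [Z' /flatten_mapP[Z Zs Z't]|Z' /flatten_mapP[Z Zs Z't] Z'y|u uy us] :=
    IH (flatten (map dec s)).
- have [irt tE] := decP Z Zs; split; first exact: irt.
  move=> [C [irC ltC]]; have [irZ] := irs Z Zs; apply.
  (* The hyperplane misses the chosen point of [Z], so a chain of length [k] in the section ends
     strictly below [Z] and can be prolonged by [Z]. *)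
  have CkZ : C k `<` Z.
    apply/proper_neqP; have [_ sCZ'] := irC k (leqnn k).
    have sCZl : C k `<=` Z `&` hyperplane l.
      by rewrite tE => x /sCZ' Z'x; exists Z'.
    split; last by move=> x /sCZl[].
    move=> eqCZ; have CkZ : C k (pt Z) by rewrite eqCZ; exact: ptP.
    have [_ [_ lpt]] := sCZl _ CkZ.
    by have := ls _ (map_f pt Zs); rewrite lpt eqxx.
  exists (fun i => if (i <= k)%N then C i else Z); split=> i ik.
    case: ifP => [ik'|_]; last by split.
    have [irCi sCi] := irC i ik'; split=> // x /sCi Z'x.
    have : (Z `&` hyperplane l) x by rewrite tE; exists Z'.
    by case.
  rewrite -ltnS ik; move: ik; rewrite ltnS leq_eqVlt => /orP[/eqP->|ik].
    by rewrite ltnn.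
  by rewrite ik; apply: ltC.
- have [irt tE] := decP Z Zs; apply: (nsy Z Zs).
  have : (Z `&` hyperplane l) y by rewrite tE; exists Z'.
  by case.
have mul_lu (x : 'cV[K]_n.+1) :
    (col_mx l u : 'M_(k.+1, n.+1)) *m x = col_mx (l *m x) (u *m x) by exact: (mul_col_mx l u x).
exists (col_mx l u : 'M_(k.+1, n.+1)); first by rewrite mul_lu ly uy; exact: (@col_mx0 _ 1 k 1).
move=> Z Zs x Zx; rewrite mul_lu; apply/eqP => eq0.
have [lx ux] : l *m x = 0 /\ u *m x = 0.
  by apply: (@eq_col_mx _ 1 k 1); rewrite col_mx0.
have [irt tE] := decP Z Zs; have [[cZ _ _] _] := irs Z Zs.
have : (Z `&` hyperplane l) x by split=> //; split=> //; apply: proj_closed_neq0 Zx.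
rewrite tE => -[Z' Z't Z'x].
have /us/(_ x Z'x) : Z' \in flatten (map dec s) by apply/flatten_mapP; exists Z.
by rewrite ux eqxx.
Qed.

End ClosedSets.

(** * The standard flag and its Schubert cells *)

Section Flag.
Variables (K : closedFieldType) (n : nat).
Implicit Types (V A B Z : set 'cV[K]_n.+1) (f g : {mpoly K[n.+1]}).

Definition flag (k : nat) : set 'cV[K]_n.+1 :=
  [set x : 'cV[K]_n.+1 | x != 0 /\ forall j : 'I_n.+1, (k < j)%N -> x j 0 = 0].

Lemma proj_closed_flag k : proj_closed (flag k).
Proof.
exists [set f | exists2 j : 'I_n.+1, (k < j)%N & f = 'X_j].
  by move=> _ [j _ ->]; exists 1%N; rewrite dhomogX /= mdeg1.
apply/seteqP; split=> x.
  by move=> [x0 xk]; apply/zero_locusP; split=> // _ [j kj ->]; rewrite mevalXU xk.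
move=> /zero_locusP[x0 xS]; split=> // j kj.
by rewrite -(xS 'X_j) ?mevalXU //; exists j.
Qed.

Lemma cV_neq0P (x : 'cV[K]_n.+1) : x != 0 -> exists i, x i 0 != 0.
Proof.
move=> x0; apply: contrapT => nx; case/eqP: x0; apply/colP => i; rewrite mxE.
by apply: contrapT => /eqP xi; apply: nx; exists i.
Qed.

(** Join a point outside A to a point outside B by a line. Along it the two separating forms are
    nonzero polynomials in the parameter, so they are nonzero together at some point of the line;
    the factor [w i] keeps this point away from the origin. *)
Lemma irreducible_flag k : irreducible_closed (flag k).
Proof.
split; first exact: proj_closed_flag.
  exists (delta_mx 0 0); split=> [|j kj].
    by apply/eqP => /matrixP/(_ 0 0); rewrite !mxE eqxx => /eqP; rewrite oner_eq0.
  by rewrite mxE; case: eqP kj => // ->.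
move=> A B cA cB sAB; apply: contrapT => nAB.
have notsub C : ~ (flag k `<=` C) -> exists2 x, flag k x & ~ C x.
  move=> nsub; apply: contrapT => nx; apply: nsub => x Fx.
  by apply: contrapT => nCx; apply: nx; exists x.
have [a [a0 ak] nAa] : exists2 x, flag k x & ~ A x by apply: notsub => sA; apply: nAB; left.
have [b [b0 bk] nBb] : exists2 x, flag k x & ~ B x by apply: notsub => sB; apply: nAB; right.
have [f [_ fA fa]] := proj_closed_sep cA a0 nAa.
have [g [_ gB gb]] := proj_closed_sep cB b0 nBb.
have [i ai] := cV_neq0P a0.
pose w (j : 'I_n.+1) := (a j 0)%:P + (b j 0 - a j 0)%:P * 'X : {poly K}.
pose y t := a + t *: (b - a).
have wE t j : (w j).[t] = y t j 0 by rewrite !hornerE !mxE mulrC.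
have substE h t : (mpoly_subst_poly w h).[t] = h.@[fun j => y t j 0].
  by rewrite horner_mpoly_subst_poly; apply: meval_eq => j; rewrite wE.
have y0 : y 0 = a by rewrite /y scale0r addr0.
have y1 : y 1 = b by rewrite /y scale1r addrC subrK.
have neq0 (p : {poly K}) t : p.[t] != 0 -> p != 0.
  by apply: contra_neq => ->; rewrite horner0.
have : w i * mpoly_subst_poly w f * mpoly_subst_poly w g != 0.
  rewrite !mulf_neq0 //; first by apply: (neq0 _ 0); rewrite wE y0.
    by apply: (neq0 _ 0); rewrite substE y0.
  by apply: (neq0 _ 1); rewrite substE y1.
move/poly_nonroot => [t]; rewrite !hornerM wE !substE !mulf_eq0 !negb_or.
move=> /andP[/andP[yi fy] gy].
have : flag k (y t).
  split=> [|j kj]; last by rewrite !mxE ak // bk // subrr mulr0 addr0.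
  by apply: contra_neq yi => ->; rewrite mxE.
by move/sAB => [/fA|/gB] eq0; move: fy gy; rewrite eq0 eqxx.
Qed.

Lemma sub_flag i j : (i <= j)%N -> flag i `<=` flag j.
Proof. by move=> ij x [x0 xi]; split=> // l jl; apply: xi; apply: leq_ltn_trans jl. Qed.

Lemma flag_proper i : (i < n)%N -> flag i `<` flag i.+1.
Proof.
move=> ni; apply/proper_neqP; split; last exact: sub_flag.
pose j : 'I_n.+1 := Ordinal (ni : (i.+1 < n.+1)%N).
have Fj : flag i.+1 (delta_mx j 0).
  split=> [|l il].
    by apply/eqP => /matrixP/(_ j 0); rewrite !mxE !eqxx => /eqP; rewrite oner_eq0.
  by rewrite mxE; case: eqP il => // ->; rewrite ltnn.
move=> eqF; move: Fj; rewrite -eqF => -[_ /(_ j (ltnSn i))].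
by rewrite mxE !eqxx => /eqP; rewrite oner_eq0.
Qed.

Lemma chain_flag k l V : (l <= k)%N -> (k <= n)%N -> flag k `<=` V ->
  has_irreducible_chain V l.
Proof.
move=> lk kn sV; exists flag; split=> i il.
  split; first exact: irreducible_flag.
  by apply: subset_trans sV; apply: sub_flag; apply: leq_trans lk.
by apply: flag_proper; apply: leq_trans il _; apply: leq_trans kn.
Qed.

Lemma proj_closedU A B : proj_closed A -> proj_closed B -> proj_closed (A `|` B).
Proof.
move=> [S hS ->] [T hT ->].
exists [set h | exists f g, [/\ S f, T g & h = f * g]].
  move=> _ [f [g [/hS[d fd] /hT[e ge] ->]]]; exists (d + e)%N; exact: dhomogM.
apply/seteqP; split=> x.
  case=> /zero_locusP[x0 Sx]; apply/zero_locusP; split=> // _ [f [g [Sf Tg ->]]].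
    by rewrite mevalM (Sx f Sf) mul0r.
  by rewrite mevalM (Sx g Tg) mulr0.
move=> /zero_locusP[x0 fgx]; apply: contrapT => nx; apply: (nx); left; apply/zero_locusP.
split=> // f Sf; apply: contrapT => /eqP fx; apply: nx; right; apply/zero_locusP.
split=> // g Tg; have /eqP : (f * g).@[fun i => x i 0] = 0 by apply: fgx; exists f, g.
by rewrite mevalM mulf_eq0 (negPf fx) => /eqP.
Qed.

Definition union_seq (s : seq (set 'cV[K]_n.+1)) : set 'cV[K]_n.+1 :=
  [set x | exists2 Z, Z \in s & Z x].

Lemma union_seq_cons Z s : union_seq (Z :: s) = Z `|` union_seq s.
Proof.
apply/seteqP; split=> x.
  by move=> [Y]; rewrite inE => /orP[/eqP->|Ys] Yx; [left|right; exists Y].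
by move=> [Zx|[Y Ys Yx]]; [exists Z|exists Y] => //; rewrite inE ?eqxx ?Ys ?orbT.
Qed.

Lemma proj_closed_union_seq s :
  {in s, forall Z, proj_closed Z} -> proj_closed (union_seq s).
Proof.
elim: s => [|Z s IH] cs.
  exists [set 1]; first by move=> _ ->; exists 0%N; rewrite dhomog1.
  apply/seteqP; split=> x; first by case.
  by move/zero_locusP => [_ /(_ 1 erefl) /eqP]; rewrite meval1 oner_eq0.
rewrite union_seq_cons; apply: proj_closedU; first by apply: cs; rewrite inE eqxx.
by apply: IH => Y Ys; apply: cs; rewrite inE Ys orbT.
Qed.

Lemma irreducible_sub_union_seq V s : irreducible_closed V ->
  {in s, forall Z, proj_closed Z} -> V `<=` union_seq s -> exists2 Z, Z \in s & V `<=` Z.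
Proof.
move=> irV; have [_ [x Vx] irrV] := irV.
elim: s => [|Z s IH] cs; first by move/(_ x Vx) => -[].
have cs' : {in s, forall Z, proj_closed Z}.
  by move=> Y Ys; apply: cs; rewrite inE Ys orbT.
rewrite union_seq_cons => /irrV [||sZ|/(IH cs')[Y Ys sY]].
- by apply: cs; rewrite inE eqxx.
- exact: proj_closed_union_seq.
- by exists Z => //; rewrite inE eqxx.
- by exists Y => //; rewrite inE Ys orbT.
Qed.

(** The open cell is dense: moving y in the direction of the k-th basis vector enters the cell for
    all but one parameter, so a form that vanishes on the cell vanishes at y. *)
Lemma sub_flag_of_cell (k : 'I_n.+1) V : proj_closed V ->
  (forall y : 'cV[K]_n.+1, y k 0 != 0 -> (forall j : 'I_n.+1, (k < j)%N -> y j 0 = 0) -> V y) ->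
  flag k `<=` V.
Proof.
move=> cV cellV y [y0 yk]; apply: contrapT => nVy.
have [f [_ fV fy]] := proj_closed_sep cV y0 nVy.
pose w (j : 'I_n.+1) := (y j 0)%:P + (j == k)%:R%:P * 'X : {poly K}.
have wE t j : (w j).[t] = (y + t *: delta_mx k 0) j 0.
  by rewrite !hornerE !mxE eqxx andbT mulrC.
have substE t : (mpoly_subst_poly w f).[t] = f.@[fun j => (y + t *: delta_mx k 0) j 0].
  by rewrite horner_mpoly_subst_poly; apply: meval_eq => j; rewrite wE.
have : w k * mpoly_subst_poly w f != 0.
  rewrite mulf_neq0 //.
    apply/eqP => /(congr1 (fun p : {poly K} => p`_1)) /eqP.
    by rewrite coefD coefC coefMX coefC eqxx coef0 add0r oner_eq0.
  apply: contra_neq fy => /(congr1 (horner^~ 0)).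
  by rewrite substE scale0r addr0 horner0.
move/poly_nonroot => [t]; rewrite hornerM wE substE mulf_eq0 negb_or => /andP[tk].
rewrite fV ?eqxx //; apply: cellV => // j kj.
rewrite !mxE yk // add0r; case: eqP kj => [->|_ _]; first by rewrite ltnn.
by rewrite mulr0.
Qed.

(** For [i < k] these are the root subgroups generating the unipotent upper triangular group, with
    additive parameter [t]. *)
Definition root_elt (i k : 'I_n.+1) (t : K) : 'M[K]_n.+1 := 1%:M + t *: delta_mx i k.

Lemma root_elt_mulE i k t (x : 'cV[K]_n.+1) j :
  (root_elt i k t *m x) j 0 = x j 0 + (j == i)%:R * (t * x k 0).
Proof.
rewrite mulmxDl mul1mx -scalemxAl mxE; congr (_ + _); rewrite mxE.
rewrite mulrCA; congr (_ * _); rewrite mxE (bigD1 k) //= big1 => [|l /negPf neq].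
  by rewrite mxE eqxx andbT addr0.
by rewrite mxE neq andbF mul0r.
Qed.

(** The cell is one orbit of root elements and scalars: [x] is scaled to the right coordinate [k],
    and then the coordinates before [k] are corrected one by one, [z c] having the first [c] of them
    in place. *)
Lemma root_elt_invariant_cell V x (k : 'I_n.+1) :
  (forall (i : 'I_n.+1) t y, (i < k)%N -> V y -> V (root_elt i k t *m y)) ->
  (forall c y, c != 0 -> V y -> V (c *: y)) ->
  V x -> x k 0 != 0 -> (forall j : 'I_n.+1, (k < j)%N -> x j 0 = 0) ->
  forall y : 'cV[K]_n.+1, y k 0 != 0 -> (forall j : 'I_n.+1, (k < j)%N -> y j 0 = 0) -> V y.
Proof.
move=> rootV scalV Vx xk xgt y yk ygt.
pose x1 := (y k 0 / x k 0) *: x.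
have x1k : x1 k 0 = y k 0 by rewrite mxE divfK.
have Vx1 : V x1 by apply: scalV => //; rewrite mulf_neq0 ?invr_eq0.
pose z c : 'cV[K]_n.+1 := \col_j (if (j < c)%N then y j 0 else x1 j 0).
have zk c : (c <= k)%N -> z c k 0 = y k 0.
  by move=> ck; rewrite mxE ltnNge ck.
have Vz c : (c <= k)%N -> V (z c).
  elim: c => [_|c IH ck].
    by have -> : z 0%N = x1 by apply/colP => j; rewrite mxE.
  have cn : (c < n.+1)%N by apply: ltn_trans (ltn_ord k).
  pose i := Ordinal cn.
  have -> : z c.+1 = root_elt i k ((y i 0 - x1 i 0) / y k 0) *m z c.
    apply/colP => j; rewrite root_elt_mulE zk; last exact: ltnW.
    rewrite divfK // !mxE ltnS leq_eqVlt -[j == i]val_eqE /=.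
    case: eqP => [jc|_] /=; last by rewrite mul0r addr0.
    have -> : j = i by apply: val_inj.
    by rewrite /= ltnn mul1r addrC subrK.
  by apply: rootV => //; apply: IH; apply: ltnW.
suff -> : y = z k by apply: Vz.
apply/colP => j; rewrite mxE; case: ltngtP => // [kj|/val_inj ->].
  by rewrite ygt // mxE (xgt j) // mulr0.
by rewrite x1k.
Qed.

Lemma cV_last_neq0 (x : 'cV[K]_n.+1) : x != 0 ->
  exists k : 'I_n.+1, x k 0 != 0 /\ forall j : 'I_n.+1, (k < j)%N -> x j 0 = 0.
Proof.
move/cV_neq0P => [i xi]; case: (@arg_maxnP _ i (fun j => x j 0 != 0) val xi) => k xk kmax.
exists k; split=> // j kj; apply: contrapT => /eqP xj.
by move: (leq_ltn_trans (kmax j xj) kj); rewrite ltnn.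
Qed.

End Flag.

(** * The support of a cycle fixed by the unipotent group *)

Section FixedCycles.
Variables (K : closedFieldType) (n m : nat).

(* The support of a fixed cycle is invariant, since its Chow form detects the
   linear spaces meeting it; hence it is a union of Schubert varieties. *)
Lemma fixed_cycle_support (Z : Defs.cycle K n) (G : {mpoly K[m.+1 * n.+1]}) :
  is_effective_cycle m Z -> is_cycle_chow_form Z G ->
  (forall (i k : 'I_n.+1) t, (i < k)%N -> exists2 c, c != 0 & act (root_elt i k t) G = c *: G) ->
  forall i x, (0 < mult i)%N -> Defs.comp (c := Z) i x -> flag m x.
Proof.
move=> effZ [g gZ GE] fixG.
(* Components of multiplicity 0 leave no trace in the Chow form, so the support omits them. *)
pose s := [seq Defs.comp i | i <- enum 'I_(ncomp Z) & (0 < mult i)%N].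
have sP i : (0 < mult i)%N -> Defs.comp (c := Z) i \in s.
  by move=> i0; apply: map_f; rewrite mem_filter i0 mem_enum.
have irs : {in s, forall V, irreducible_closed V /\ has_dim V m}.
  by move=> V /mapP[i _ ->]; exact: effZ.
have cs : {in s, forall V, proj_closed V} by move=> V /irs[[]].
pose W := union_seq s.
have cW : proj_closed W by exact: proj_closed_union_seq.
have G0 (u : 'M[K]_(m.+1, n.+1)) : G.@[mxvec u 0] = 0 <-> exists2 x, W x & u *m x = 0.
  have GuE : G.@[mxvec u 0] = \prod_i (g i).@[mxvec u 0] ^+ mult i.
    by rewrite GE rmorph_prod; apply: eq_bigr => i _; rewrite rmorphXn.
  rewrite GuE; split=> [/eqP|[x [V /mapP[i]]]].
    move/prodf_eq0 => [i _]; rewrite expf_eq0 => /andP[i0 /eqP /(gZ i).2 [x [Vx ux]]].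
    by exists x => //; exists (Defs.comp i) => //; exact: sP.
  rewrite mem_filter => /andP[i0 _] -> Vx ux; apply/eqP/prodf_eq0; exists i => //.
  rewrite expf_eq0 i0 /=; apply/eqP/(gZ i).2.
  by exists x.
have invW (i k : 'I_n.+1) t y : (i < k)%N -> W y -> W (root_elt i k t *m y).
  move=> ik Wy; apply: contrapT => nW.
  have y0 : root_elt i k t *m y != 0.
    have yn0 := proj_closed_neq0 cW Wy.
    have ri : root_elt i k (- t) *m (root_elt i k t *m y) = y.
      have ki : (k == i) = false by rewrite -val_eqE /= gtn_eqF.
      apply/colP => j; rewrite !root_elt_mulE ki mul0r addr0 -addrA -mulrDr.
      by rewrite mulNr subrr mulr0 addr0.
    by apply: contra_neq yn0 => eq0; rewrite -ri eq0 mulmx0.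
  (* Take a space through the translate and off [W]. The translated form vanishes at its equations
     [u]; being a multiple of [G], it makes [G] vanish there, so the space meets [W] after all. *)
  have [||u uy uW] := @linear_space_avoiding _ _ m.+1 s _ y0.
  - by move=> V /irs[irV [_ ncV]].
  - by move=> V Vs Vy; apply: nW; exists V.
  have [c c0 cG] := fixG i k t ik.
  have : (act (root_elt i k t) G).@[mxvec u 0] = 0.
    by rewrite meval_act; apply/G0; exists y => //; rewrite -mulmxA.
  rewrite cG mevalZ => /eqP; rewrite mulf_eq0 (negPf c0) /= => /eqP/G0[x [V Vs Vx] ux].
  by have := uW V Vs x Vx; rewrite ux eqxx.
move=> i x i0 Vx; have Wx : W x by exists (Defs.comp i) => //; exact: sP.
have x0 := proj_closed_neq0 cW Wx.
have [k [xk xgt]] := cV_last_neq0 x0.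
split=> // j mj; apply: (xgt); apply: leq_ltn_trans mj.
(* [k] is the last nonzero coordinate of [x]. The plane [flag k] lies in one component, and for k >
   m its subplanes would form too long a chain there. *)
have /irreducible_sub_union_seq : flag k `<=` W.
  apply: sub_flag_of_cell => //; apply: (root_elt_invariant_cell _ _ Wx xk xgt).
    by move=> l t y lk; exact: invW.
  by move=> c y c0; exact: proj_closedZ.
move=> /(_ (@irreducible_flag K n k) cs) [V Vs sV].
rewrite leqNgt; apply/negP => mk; have [_ [_]] := irs V Vs; apply.
by apply: chain_flag sV; rewrite // -ltnS.
Qed.

End FixedCycles.

(** * Krull dimension of the standard planes *)

Section Dimension.
Variables (K : closedFieldType) (n : nat).
Implicit Types (Z : set 'cV[K]_n.+1) (f g : {mpoly K[n.+1]}).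

(** Irreducibility only speaks of homogeneous equations, while [h] is arbitrary. Comparing the
    powers of c in the values at c x shows that f times each homogeneous part of [h] vanishes on
    [Z]; hence [Z] lies in the zeros of f or in the common zeros of the parts. *)
Lemma irreducible_cancel Z e f (h : {mpoly K[n.+1]}) : irreducible_closed Z -> f \is e.-homog ->
  ~ vanishes_on Z f -> vanishes_on Z (f * h) -> vanishes_on Z h.
Proof.
move=> [cZ _ irrZ] fe fZ fhZ.
pose hd d := pihomog mdeg d h.
have hE : h = \sum_(d < msize h) hd d by exact: pihomog_partitionE.
have hdZ x d : Z x -> f.@[fun i => x i 0] * (hd d).@[fun i => x i 0] = 0.
  move=> Zx; have [hm|hm] := leqP (msize h) d.
    suff -> : hd d = 0 by rewrite meval0 mulr0.
    rewrite /hd pihomogE big_seq_cond big1 // => mu /andP[/msize_mdeg_lt lt_mu /eqP mu_d].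
    by move: lt_mu; rewrite mu_d ltnNge hm.
  pose p : {poly K} :=
    \sum_(d' < msize h) (f.@[fun i => x i 0] * (hd d').@[fun i => x i 0]) *: 'X^d'.
  have p0 c : c != 0 -> p.[c] = 0.
    move=> c0; have := fhZ _ (proj_closedZ cZ c0 Zx).
    rewrite mevalM; have [/(_ fe) -> _] := dhomog_cVP e f.
    rewrite {1}hE raddf_sum -mulrA mulr_sumr /= => /eqP.
    rewrite mulf_eq0 expf_eq0 (negPf c0) andbF /= => /eqP eq0.
    rewrite -[RHS]eq0 horner_sum; apply: eq_bigr => d' _.
    rewrite hornerZ hornerXn -mulrA; congr (_ * _); rewrite mulrC.
    by have [/(_ (pihomogP _ _ _)) -> _] := dhomog_cVP d' (hd d').
  (* The vanishing of [p] is known only at nonzero c, since the cone is punctured; the factor 'X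
     takes care of 0. *)
  have Xp0 : 'X * p = 0.
    apply: poly_eq0_horner => c; rewrite hornerM hornerX.
    by have [->|/p0->] := eqVneq c 0; rewrite ?mul0r ?mulr0.
  have /eqP : p = 0 by apply/eqP; move/eqP: Xp0; rewrite mulf_eq0 polyX_eq0.
  move=> /eqP/(congr1 (fun q : {poly K} => q`_d)); rewrite coef0 coef_sum.
  rewrite (bigD1 (Ordinal hm)) //= big1 ?addr0 => [|d' /negPf neq].
    by rewrite coefZ coefXn eqxx mulr1.
  by rewrite coefZ coefXn eq_sym -[d' == d :> nat]/(d' == Ordinal hm) neq mulr0.
have cF : proj_closed (zero_locus [set f]) by exists [set f] => // _ ->; exists e.
have cH : proj_closed (zero_locus [set g | exists d, g = hd d]).
  by exists [set g | exists d, g = hd d] => // _ [d ->]; exists d; exact: pihomogP.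
have [|sF|sH] := irrZ _ _ cF cH.
- move=> x Zx; have x0 := proj_closed_neq0 cZ Zx.
  have [fx|fx] := eqVneq (f.@[fun i => x i 0]) 0.
    by left; apply/zero_locusP; split=> // _ ->.
  right; apply/zero_locusP; split=> // _ [d ->].
  by apply/eqP; move/eqP: (hdZ x d Zx); rewrite mulf_eq0 (negPf fx).
- by case: fZ => x /sF/zero_locusP[_]; apply.
- move=> x /sH/zero_locusP[_ hx]; rewrite hE raddf_sum big1 // => d _.
  by apply: hx; exists d.
Qed.

(** The product of the powers of f_0, ..., f_k whose exponents are the base-B digits of [a], for a <
    B^(k+1). Coding exponents in one number turns algebraic relations into linear ones over a
    range. *)
Fixpoint digit_monomial (B : nat) (f : nat -> {mpoly K[n.+1]}) (k a : nat) : {mpoly K[n.+1]} :=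
  if k is k'.+1 then
    digit_monomial B f k' (a %% B ^ k'.+1)%N * f k'.+1 ^+ (a %/ B ^ k'.+1)%N
  else f 0%N ^+ a.

Lemma msizeX_leq f e k : (msize f <= e.+1)%N -> (msize (f ^+ k) <= (k * e).+1)%N.
Proof.
move=> fe; elim: k => [|k IH]; first by rewrite expr0 msize1.
have [->|f0] := eqVneq f 0; first by rewrite expr0n /= msize0.
rewrite exprS msizeM ?expf_neq0 // -subn1 leq_subLR.
apply: leq_trans (leq_add fe IH) _.
by rewrite mulSn addSn addnS add1n.
Qed.

Lemma msizeM_leq f g a b : (msize f <= a.+1)%N -> (msize g <= b.+1)%N ->
  (msize (f * g) <= (a + b).+1)%N.
Proof.
move=> fa gb; have [->|f0] := eqVneq f 0; first by rewrite mul0r msize0.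
have [->|g0] := eqVneq g 0; first by rewrite mulr0 msize0.
by rewrite msizeM // -subn1 leq_subLR; apply: leq_trans (leq_add fa gb) _;
  rewrite addSn addnS add1n.
Qed.

Lemma msize_digit_monomial B (f : nat -> {mpoly K[n.+1]}) e k a :
  (forall i, (i <= k)%N -> (msize (f i) <= e.+1)%N) -> (a < B ^ k.+1)%N ->
  (msize (digit_monomial B f k a) <= (k.+1 * (B * e)).+1)%N.
Proof.
elim: k a => [|k IH] a fe aB /=.
  apply: leq_trans (msizeX_leq _ (fe 0%N isT)) _; rewrite mul1n ltnS leq_mul2r.
  by rewrite (ltnW _) ?orbT // -(expn1 B).
have B0 : (0 < B)%N by move: aB; case: (B) => //; rewrite exp0n.
rewrite mulSn addnC; apply: msizeM_leq.
  by apply: IH => [i ik|]; [apply: fe; apply: leqW|rewrite ltn_mod expn_gt0 B0].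
apply: leq_trans (msizeX_leq _ (fe k.+1 (leqnn _))) _.
rewrite ltnS leq_mul2r ltnW ?orbT // ltn_divLR ?expn_gt0 ?B0 //.
Qed.

(** Algebraic independence along a chain. Order a relation by powers of f_{k+1}; the lowest power
    cancels because Z_{k+1} is irreducible, and restriction to Z_k, where f_{k+1} vanishes, leaves a
    relation among f_0, ..., f_k. *)
Lemma digit_monomials_free B (Z : nat -> set 'cV[K]_n.+1) (f : nat -> {mpoly K[n.+1]}) j N :
  (forall i, (i <= N)%N -> irreducible_closed (Z i)) ->
  (forall i, (i < N)%N -> Z i `<=` Z i.+1) ->
  f 0%N = 'X_j ->
  (forall i, (i <= N)%N -> ~ vanishes_on (Z i) (f i)) ->
  (forall i, (i < N)%N -> (exists e, f i.+1 \is e.-homog) /\ vanishes_on (Z i) (f i.+1)) ->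
  forall k, (k <= N)%N -> forall c : nat -> K,
  vanishes_on (Z k) (\sum_(0 <= a < B ^ k.+1) c a *: digit_monomial B f k a) ->
  forall a, (a < B ^ k.+1)%N -> c a = 0.
Proof.
move=> irZ sZ f0 fZ fv; elim=> [|k IH] kN c sum0 a aB.
  have [cZ _ _] := irZ _ kN.
  have [x [Zx xj]] : exists x, Z 0%N x /\ x j 0 != 0.
    apply: contrapT => nx; apply: (fZ 0%N) => // x Zx; rewrite f0 mevalXU.
    by apply: contrapT => /eqP xj; apply: nx; exists x.
  pose p : {poly K} := \sum_(0 <= a < B ^ 1) c a *: 'X^a.
  have p0 t : t != 0 -> p.[t] = 0.
    move=> t0; have s0 : t / x j 0 != 0 by rewrite mulf_neq0 ?invr_eq0.
    rewrite -(sum0 _ (proj_closedZ cZ s0 Zx)) horner_sum raddf_sum.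
    apply: eq_bigr => b _ /=.
    by rewrite hornerZ hornerXn mevalZ rmorphXn /= f0 mevalXU mxE divfK.
  have Xp0 : 'X * p = 0.
    apply: poly_eq0_horner => t; rewrite hornerM hornerX.
    by have [->|/p0->] := eqVneq t 0; rewrite ?mul0r ?mulr0.
  have pE0 : p = 0 by apply/eqP; move/eqP: Xp0; rewrite mulf_eq0 polyX_eq0.
  have := congr1 (fun q : {poly K} => q`_a) pE0; rewrite coef0 => <-.
  rewrite coef_sum (bigD1_seq a) ?mem_index_iota ?iota_uniq //=.
  rewrite coefZ coefXn eqxx mulr1 big1 ?addr0 // => b /negPf neq.
  by rewrite coefZ coefXn eq_sym neq mulr0.
set M := (B ^ k.+1)%N in sum0 aB *.
have [[e fe] fvk] := fv k kN.
pose S h := \sum_(0 <= l < M) c (h * M + l)%N *: digit_monomial B f k l.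
have B0 : (0 < B)%N by move: aB; case: (B) => //; rewrite exp0n.
have M0 : (0 < M)%N by rewrite expn_gt0 B0.
have sumE : \sum_(0 <= a < B ^ k.+2) c a *: digit_monomial B f k.+1 a =
    \sum_(0 <= h < B) S h * f k.+1 ^+ h.
  rewrite expnS big_nat_mul; apply: eq_big_nat => h _.
  rewrite mulSn -{1}[(h * M)%N]add0n big_addn addnK mulr_suml.
  apply: eq_big_nat => l /andP[_ lM].
  rewrite addnC /= -/M modnMDl modn_small // divnMDl // divn_small // addn0.
  by rewrite scalerAl.
have step h : (h <= B)%N -> forall b, (b < h * M)%N -> c b = 0.
  elim: h => [|h IHh] hB b bM; first by rewrite mul0n in bM.
  have {}IHh := IHh (ltnW hB).
  have [/IHh//|hb] := ltnP b (h * M).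
  rewrite -(subnKC hb); apply: (IH (ltnW kN) (fun l => c (h * M + l)%N)); last first.
    by rewrite ltn_subLR // addnC -mulSn.
  (* With all blocks before [h] already zero, the relation reads
     [f k.+1 ^+ h * (S h + f k.+1 * R)]. *)
  pose R := \sum_(h.+1 <= i < B) S i * f k.+1 ^+ (i - h.+1).
  have van : vanishes_on (Z k.+1) (S h + f k.+1 * R).
    apply: (@irreducible_cancel _ (e * h) (f k.+1 ^+ h)).
    - exact: irZ.
    - exact: dhomogMn.
    - move=> fh0; apply: (fZ k.+1 kN) => x Zx; apply/eqP.
      by have /eqP := fh0 x Zx; rewrite rmorphXn /= expf_eq0 => /andP[].
    - suff <- : \sum_(0 <= a < B ^ k.+2) c a *: digit_monomial B f k.+1 a =
        f k.+1 ^+ h * (S h + f k.+1 * R) by [].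
      rewrite sumE (big_cat_nat (n := h)) ?(ltnW hB) //=.
      rewrite big_nat big1 ?add0r => [|i /andP[_ ih]]; last first.
        rewrite /S big_nat big1 ?mul0r // => l /andP[_ lM].
        rewrite IHh ?scale0r //; apply: leq_trans (leq_mul ih (leqnn M)).
        by rewrite mulSn addnC ltn_add2r.
      rewrite big_ltn // mulrDr mulrC; congr (_ + _).
      rewrite mulrA -exprSr mulr_sumr; apply: eq_big_nat => i /andP[hi _].
      by rewrite mulrCA -exprD subnKC.
  move=> x Zx; have := van x (sZ k kN x Zx).
  by rewrite mevalD mevalM fvk // mul0r addr0.
by apply: (step B) => //; rewrite -expnS.
Qed.

(** On [flag m] only m+1 variables survive, so for N > m and large B the B^(N+1) products outnumber
    the monomials that can occur, and a kernel vector gives the relation. *)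
Lemma digit_monomials_dependent m (f : nat -> {mpoly K[n.+1]}) N :
  (m < N)%N -> exists B (c : nat -> K),
    vanishes_on (flag m) (\sum_(0 <= a < B ^ N.+1) c a *: digit_monomial B f N a) /\
    exists2 a, (a < B ^ N.+1)%N & c a != 0.
Proof.
move=> mN.
pose e := \max_(i < N.+1) msize (f i).
have fe i : (i <= N)%N -> (msize (f i) <= e.+1)%N.
  by move=> iN; apply: leqW; apply: (leq_bigmax (Ordinal (iN : (i < N.+1)%N))).
(* [E] bounds the degrees, so at most (E+1)^(m+1) monomials occur. As E+1 <= C B, this is at most
   C^(m+1) B^(m+1), which the choice of [B] puts below B^(m+2). *)
pose C := (N.+1 * e).+1; pose B := (C ^ m.+1).+1; pose E := (N.+1 * (B * e))%N.
pose T := {ffun 'I_m.+1 -> 'I_E.+1}.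
have cardT : (#|{: T}| < B ^ N.+1)%N.
  rewrite card_ffun !card_ord.
  have EC : (E.+1 <= C * B)%N.
    by rewrite /E /C (mulnC B e) mulnA -[in leqRHS]addn1 mulnDl mul1n -addn1 leq_add2l.
  apply: (@leq_ltn_trans ((C * B) ^ m.+1)%N); first by rewrite leq_exp2r.
  rewrite expnMn; apply: (@leq_trans (B ^ m.+2)); last by rewrite leq_pexp2l.
  by rewrite [(B ^ m.+2)%N]expnS ltn_mul2r expn_gt0 /B ltnSn.
pose mu (phi : T) := [multinom (if (j < m.+1)%N then (phi (inord j) : nat) else 0%N) | j < n.+1].
pose A := \matrix_(a < (B ^ N.+1)%N, t < #|{: T}|)
  (digit_monomial B f N a)@_(mu (enum_val t)).
have : kermx A != 0.
  rewrite kermx_eq0 /row_free neq_ltn; apply/orP; left.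
  exact: leq_ltn_trans (rank_leq_col A) cardT.
move/rowV0Pn => [v /sub_kermxP vA v0].
pose c a := if (insub a : option 'I_(B ^ N.+1)) is Some i then v 0 i else 0.
have cE (i : 'I_(B ^ N.+1)) : c i = v 0 i by rewrite /c valK.
exists B, c; split; last first.
  have [i vi] : exists i, v 0 i != 0.
    apply: contrapT => ni; case/eqP: v0; apply/rowP => i; rewrite mxE.
    by apply: contrapT => /eqP vi; apply: ni; exists i.
  by exists i; rewrite ?cE.
move=> x [_ xm]; rewrite big_mkord; set g := \sum_i _.
rewrite mevalE big_seq big1 // => nu nug.
have [[j mj nuj]|nu_m] := pselect (exists2 j : 'I_n.+1, (m < j)%N & nu j != 0%N).
  by rewrite (bigD1 j) //= xm // expr0n (negPf nuj) mul0r mulr0.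
have nuE j : (nu j < E.+1)%N.
  have : (mdeg nu < E.+1)%N.
    apply: leq_trans (msize_mdeg_lt nug) _.
    apply: leq_trans (msize_sum _ _ _) _; apply/bigmax_leqP => i _.
    apply: leq_trans (msizeZ_le _ _) _; exact: msize_digit_monomial.
  by apply: leq_ltn_trans; rewrite mdegE (bigD1 j) //= leq_addr.
pose phi : T := [ffun i : 'I_m.+1 => inord (nu (inord i))].
have muE : mu phi = nu.
  apply/mnmP => j; rewrite mnmE; case: ifP => [jm|/negbT jm].
    by rewrite ffunE inordK // inordK // inord_val.
  rewrite -leqNgt in jm; apply/esym/eqP; apply: contrapT => /negP nuj.
  by apply: nu_m; exists j.
have := congr1 (fun M : 'rV_#|{: T}| => M 0 (enum_rank phi)) vA.
rewrite !mxE => eq0; rewrite [g@_nu](_ : _ = 0) ?mul0r // -[RHS]eq0 raddf_sum /=.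
by apply: eq_bigr => i _; rewrite mcoeffZ cE mxE enum_rankK muE.
Qed.

(** A chain Z_0, ..., Z_{m+1} would give m+2 independent polynomials: one form for each strict
    inclusion, and a coordinate not vanishing on Z_0, which accounts for the extra dimension of the
    cone. The count allows only m+1. *)
Lemma no_long_chain_flag m : ~ has_irreducible_chain (flag (K := K) (n := n) m) m.+1.
Proof.
move=> [Z [irZ ltZ]].
have sZ i : (i < m.+1)%N -> Z i `<=` Z i.+1 by move/ltZ/proper_neqP => [].
have [[cZ0 [x0 Zx0] _] _] := irZ 0%N isT.
have [j xj] := cV_neq0P (proj_closed_neq0 cZ0 Zx0).
have /choice[f1 f1P] i : exists f, (i < m.+1)%N ->
    [/\ exists e : nat, f \is e.-homog, vanishes_on (Z i) f & ~ vanishes_on (Z i.+1) f].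
  have [im|_] := boolP (i < m.+1)%N; last by exists 0.
  have [[cZ _ _] _] := irZ i (ltnW im); have [[cZ1 _ _] _] := irZ i.+1 im.
  have [x Zx nZx] : exists2 x, Z i.+1 x & ~ Z i x.
    have /proper_neqP[neq sub] := ltZ i im.
    apply: contrapT => nx; apply: neq; apply/seteqP; split=> // x Zx.
    by apply: contrapT => nZx; apply: nx; exists x.
  have [f [fe fv fx]] := proj_closed_sep cZ (proj_closed_neq0 cZ1 Zx) nZx.
  exists f => _; split=> // fv1; by rewrite fv1 // eqxx in fx.
pose f i := if i is i'.+1 then f1 i' else 'X_j.
have [B [c [sum0 [a aB ca]]]] := digit_monomials_dependent f (ltnSn m).
case/eqP: ca; apply: (@digit_monomials_free B Z f j m.+1 _ _ _ _ _ m.+1 (leqnn m.+1) c _ a aB) => //.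
- by move=> i /irZ[].
- move=> [_ fZ|i im]; last by have [] := f1P i im.
  by move: xj; rewrite -(mevalXU (fun i => x0 i 0) j) fZ // eqxx.
- by move=> i im; have [] := f1P i im.
- by move=> x Zx; apply: sum0; have [_] := irZ m.+1 (leqnn _); apply.
Qed.

Lemma has_dim_flag m : (m <= n)%N -> has_dim (flag (K := K) (n := n) m) m.
Proof. by move=> mn; split; [exact: chain_flag mn _|exact: no_long_chain_flag]. Qed.

End Dimension.

(** * The leading minor as Chow form of the standard plane *)

Section LeadingMinor.
Variables (K : closedFieldType) (n : nat).

Definition lead_cols p q (u : 'M[K]_(p, n.+1)) : 'M[K]_(p, q) :=
  \matrix_(i, j) u i (inord j).

Definition ext_cols p q (w : 'M[K]_(p, q.+1)) : 'M[K]_(p, n.+1) :=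
  \matrix_(i, j) if (j < q.+1)%N then w i (inord j) else 0.

Lemma ext_colsK p q : (q <= n)%N -> cancel (@ext_cols p q) (@lead_cols p q.+1).
Proof.
move=> qn w; apply/matrixP => i j; rewrite !mxE.
have jn : (j < n.+1)%N by apply: leq_trans (ltn_ord j) _.
by rewrite inordK // ltn_ord inord_val.
Qed.

Lemma sum_lead (q : nat) (F : 'I_n.+1 -> K) : (q <= n.+1)%N ->
  (forall j : 'I_n.+1, (q <= j)%N -> F j = 0) ->
  \sum_j F j = \sum_(j < q) F (inord j).
Proof.
move=> qn F0; rewrite (eq_bigr (fun j : 'I_n.+1 => F (inord j))) => [|j _]; last first.
  by rewrite inord_val.
rewrite -!(big_mkord xpredT (fun j => F (inord j))) (big_cat_nat (leq0n q) qn) /=.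
rewrite [X in _ + X]big_nat [X in _ + X]big1 ?addr0 // => j /andP[qj jn].
by rewrite F0 // inordK.
Qed.

Lemma mulmx_lead p q (u : 'M[K]_(p, n.+1)) (x : 'cV[K]_n.+1) : (q <= n.+1)%N ->
  (forall j : 'I_n.+1, (q <= j)%N -> x j 0 = 0) ->
  u *m x = lead_cols q u *m \col_(j < q) x (inord j) 0.
Proof.
move=> qn xq; apply/matrixP => i k; rewrite !ord1 !mxE (@sum_lead q) // => [|j qj].
  by apply: eq_bigr => j _; rewrite !mxE.
by rewrite xq // mulr0.
Qed.

Lemma lead_kernel0 q (u : 'M[K]_(q, n.+1)) (x : 'cV[K]_n.+1) : (q <= n.+1)%N ->
  (forall j : 'I_n.+1, (q <= j)%N -> x j 0 = 0) ->
  \det (lead_cols q u) != 0 -> u *m x = 0 -> x = 0.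
Proof.
move=> qn xq detu; rewrite (mulmx_lead _ qn xq) => ux.
have unit_u : lead_cols q u \in unitmx by rewrite unitmxE unitfE.
have /colP x0 : \col_(j < q) x (inord j) 0 = 0.
  by rewrite -(mulKmx unit_u (\col__ _)) ux mulmx0.
apply/colP => j; rewrite mxE; have [jq|/xq//] := ltnP j q.
by have := x0 (Ordinal jq); rewrite !mxE /= inord_val.
Qed.

Lemma lead_kernel_neq0 q (u : 'M[K]_(q, n.+1)) : (q <= n.+1)%N ->
  \det (lead_cols q u) = 0 ->
  exists x : 'cV[K]_n.+1,
    [/\ x != 0, forall j : 'I_n.+1, (q <= j)%N -> x j 0 = 0 & u *m x = 0].
Proof.
move=> qn /eqP; rewrite -det_tr => /det0P[v v0 vu].
case: q u qn v v0 vu => [|q] u qn v v0 vu.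
  by case/eqP: v0; apply/rowP => -[].
pose x : 'cV[K]_n.+1 := \col_j if (j < q.+1)%N then v 0 (inord j) else 0.
have xq (j : 'I_n.+1) : (q.+1 <= j)%N -> x j 0 = 0.
  by move=> qj; rewrite mxE ltnS leqNgt qj.
have xE : \col_(j < q.+1) x (inord j) 0 = v^T.
  apply/colP => j; rewrite !mxE inordK ?ltn_ord ?inord_val //.
  exact: leq_trans (ltn_ord j) qn.
exists x; split=> //.
  apply: contra_neq v0 => x0; rewrite -[v]trmxK -xE x0.
  by apply/rowP => j; rewrite !mxE.
by rewrite (mulmx_lead _ qn xq) xE -[lead_cols _ u]trmxK -trmx_mul vu trmx0.
Qed.

(** A Plücker coordinate of the row space. For q = m+1 it is the Chow form of the standard m-plane;
    for q = m it is the genericity condition witnessing that this plane has degree 1. *)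
Definition lead_minor q : {mpoly K[q * n.+1]} :=
  \det (\matrix_(i < q, j < q) 'X_(mxvec_index i (inord j : 'I_n.+1))).

Lemma meval_lead_minor q (u : 'M[K]_(q, n.+1)) :
  (lead_minor q).@[mxvec u 0] = \det (lead_cols q u).
Proof.
rewrite /lead_minor -det_map_mx; congr (\det _); apply/matrixP => i j.
by rewrite !mxE /= mevalXU mxvecE.
Qed.

Lemma lead_cols_scale_row m d (i : 'I_m) c (u : 'M[K]_(m, n.+1)) :
  \det (lead_cols m (scale_row i c u)) ^+ d = c ^+ d * \det (lead_cols m u) ^+ d.
Proof.
rewrite -exprMn; congr (_ ^+ d).
have -> : lead_cols m (scale_row i c u) =
    diag_mx (\row_k c ^+ (k == i)) *m lead_cols m u.
  by apply/matrixP => k j; rewrite mul_diag_mx !mxE.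
rewrite det_mulmx det_diag (bigD1 i) //= mxE eqxx expr1 big1 ?mulr1 // => k /negPf neq.
by rewrite mxE neq expr0.
Qed.

Lemma multihomogeneous_lead_minor m d :
  multihomogeneous d (lead_minor m.+1 ^+ d).
Proof.
apply/multihomogeneousP => i c u.
by rewrite !rmorphXn /= !meval_lead_minor lead_cols_scale_row.
Qed.

Lemma lead_minor_neq0 q : (q <= n.+1)%N -> lead_minor q != 0.
Proof.
move=> qn; apply/eqP => /(congr1 (meval (mxvec (\matrix_(i < q, j < n.+1) (i == j :> nat)%:R) 0))).
rewrite meval_lead_minor meval0 (_ : lead_cols _ _ = 1%:M) ?det1.
  by move/eqP; rewrite oner_eq0.
by apply/matrixP => i j; rewrite !mxE inordK // (leq_trans (ltn_ord j)).
Qed.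

Lemma chow_zero_lead_minor m (u : 'M[K]_(m.+1, n.+1)) : (m <= n)%N ->
  (lead_minor m.+1).@[mxvec u 0] = 0 <-> linear_section (flag (n := n) m) u !=set0.
Proof.
move=> mn; rewrite meval_lead_minor; split.
  move/(@lead_kernel_neq0 m.+1 u mn) => [x [x0 xm ux]].
  by exists x; split=> //; split.
move=> [x [[x0 xm] ux]]; apply/eqP; apply: contraT => detu; case/eqP: x0.
by apply: lead_kernel0 detu ux.
Qed.

(** When the leading m-minor is nonzero, a solution in the plane is determined by its coordinate of
    index m, so the solutions form one projective point. *)
Lemma has_degree_flag m : (m <= n)%N -> has_degree m (flag (K := K) (n := n) m) 1.
Proof.
move=> mn; exists (lead_minor m); first by apply: lead_minor_neq0; apply: leqW.
move=> u; rewrite meval_lead_minor => detu.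
(* A zero row is added to make the leading block square and singular, which provides a nonzero
   solution. *)
pose u' : 'M[K]_(m.+1, n.+1) := \matrix_(i, j)
  if unlift ord_max i is Some i' then u i' j else 0.
have ker (x : 'cV[K]_n.+1) : u' *m x = 0 -> u *m x = 0.
  move=> u'x; apply/matrixP => i k;
    have := congr1 (fun M => fun_of_matrix M (lift ord_max i) k) u'x.
  by rewrite !mxE => eq0; rewrite -[RHS]eq0; apply: eq_bigr => j _; rewrite mxE liftK.
have [|x [x0 xm u'x]] := @lead_kernel_neq0 m.+1 u' mn.
  rewrite (expand_det_row _ ord_max) big1 // => j _.
  by rewrite !mxE unlift_none mul0r.
have ux := ker x u'x.
have lx : linear_section (flag m) u x by split.
pose M : 'I_n.+1 := inord m.
have ME : M = m :> nat by rewrite inordK.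
have zero_M (y : 'cV[K]_n.+1) : (forall j : 'I_n.+1, (m < j)%N -> y j 0 = 0) ->
    u *m y = 0 -> y M 0 = 0 -> y = 0.
  move=> ym uy yM; apply: lead_kernel0 detu uy; first exact: leqW.
  move=> j; rewrite leq_eqVlt => /orP[/eqP mj|/ym//].
  by rewrite -yM; congr (y _ 0); apply: val_inj; rewrite /= ME.
have xM : x M 0 != 0 by apply: contra_neq x0; apply: zero_M.
have -> : proj_point (W:='cV[K]_n.+1) @` linear_section (flag m) u = (fun=> proj_point x) @` `I_1.
  apply/seteqP; split=> P; last by move=> [_ _ <-]; exists x.
  move=> [y [[y0 ym] /= uy] <-]; exists 0%N => //.
  have yM : y M 0 != 0 by apply: contra_neq y0; apply: zero_M.
  pose c := y M 0 / x M 0.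
  have c0 : c != 0 by rewrite mulf_neq0 ?invr_eq0.
  have yE : y = c *: x.
    apply/eqP; rewrite -subr_eq0; apply/eqP; apply: zero_M.
    - by move=> j mj; rewrite !mxE ym // xm // mulr0 subrr.
    - by rewrite mulmxBr -scalemxAr uy ux scaler0 subrr.
    - by rewrite !mxE divfK // subrr.
  apply/esym/seteqP; split=> z [a a0 <-].
    by exists (a * c); [rewrite /= mulf_neq0|rewrite yE scalerA].
  exists (a / c); first by rewrite /= mulf_neq0 ?invr_eq0.
  by rewrite yE scalerA divfK.
by apply: inj_card_eq => i j; rewrite !inE /=; case: i j => [|//] [].
Qed.

End LeadingMinor.

(** * Reduction of invertible matrices by transvections *)

Section Transvections.
Variable K : fieldType.

(** Square-zero T rather than elementary matrices: the class passes to blocks without indices, and 1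
    + sT is invertible for every s, as the argument along lines requires. *)
Definition transvection_invariant (X : Type) N (f : 'M[K]_N -> X) :=
  forall T u : 'M[K]_N, T *m T = 0 -> u \in unitmx -> f ((1%:M + T) *m u) = f u.

Lemma square_zero_inv N (T : 'M[K]_N) : T *m T = 0 -> (1%:M + T) *m (1%:M - T) = 1%:M.
Proof.
by move=> TT; rewrite mulmxDl mul1mx mulmxBr TT mulmx1 subr0 subrK.
Qed.

Lemma unitmx_square_zero N (T : 'M[K]_N) : T *m T = 0 -> 1%:M + T \in unitmx.
Proof. by move/square_zero_inv/mulmx1_unit => []. Qed.

(** Row operations by blocks: a nonzero entry below the corner is used to turn the corner into 1,
    after which the rest of the first column and first row is cleared. *)
Lemma transvection_reduction (X : Type) N (f : 'M[K]_(1 + N.+1) -> X) u :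
  transvection_invariant f -> u \in unitmx ->
  exists2 D : 'M[K]_N.+1, D \in unitmx & f u = f (block_mx 1%:M 0 0 D).
Proof.
move=> invf; have up a b c (D : 'M_N.+1) (t : 'rV_N.+1) : block_mx a b c D \in unitmx ->
    f (block_mx (a + t *m c) (b + t *m D) c D) = f (block_mx a b c D) /\
    block_mx (a + t *m c) (b + t *m D) c D \in unitmx.
  move=> uu; have TT : block_mx 0 t 0 0 *m block_mx 0 t 0 0 = 0 :> 'M_(1 + N.+1).
    by rewrite mulmx_block !mulmx0 !mul0mx !addr0; apply: block_mx0.
  have <- : (1%:M + block_mx 0 t 0 0) *m block_mx a b c D =
      block_mx (a + t *m c) (b + t *m D) c D.
    by rewrite mulmxDl mul1mx mulmx_block !mul0mx !add0r add_block_mx !addr0.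
  by rewrite invf // unitmx_mul unitmx_square_zero.
have down a b c (D : 'M_N.+1) (v : 'cV_N.+1) : block_mx a b c D \in unitmx ->
    f (block_mx a b (c + v *m a) (D + v *m b)) = f (block_mx a b c D) /\
    block_mx a b (c + v *m a) (D + v *m b) \in unitmx.
  move=> uu; have TT : block_mx 0 0 v 0 *m block_mx 0 0 v 0 = 0 :> 'M_(1 + N.+1).
    by rewrite mulmx_block !mulmx0 !mul0mx !addr0; apply: block_mx0.
  have <- : (1%:M + block_mx 0 0 v 0) *m block_mx a b c D =
      block_mx a b (c + v *m a) (D + v *m b).
    by rewrite mulmxDl mul1mx mulmx_block !mul0mx !addr0 add_block_mx !addr0.
  by rewrite invf // unitmx_mul unitmx_square_zero.
have clear1 b c (D : 'M_N.+1) : block_mx 1%:M b c D \in unitmx ->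
    exists2 D' : 'M_N.+1, D' \in unitmx & f (block_mx 1%:M b c D) = f (block_mx 1%:M 0 0 D').
  move=> uu; have [] := down _ _ _ _ (- c) uu; rewrite mulmx1 subrr => <-.
  set D' := _ + _ => uu'; exists D'.
    by move: uu'; rewrite !unitmxE det_ublock det1 mul1r.
  have uD' : D' \in unitmx by move: uu'; rewrite !unitmxE det_ublock det1 mul1r.
  have [<- _] := up _ _ _ _ (- (b *m invmx D')) uu'.
  by rewrite mulmx0 addr0 mulNmx mulmxKV // subrr.
have clear_col a b c (D : 'M_N.+1) : c != 0 -> block_mx a b c D \in unitmx ->
    exists2 D' : 'M_N.+1, D' \in unitmx & f (block_mx a b c D) = f (block_mx 1%:M 0 0 D').
  move=> c0 uu; have [i ci] : exists i, c i 0 != 0.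
    apply: contrapT => ni; case/eqP: c0; apply/colP => i; rewrite mxE.
    by apply: contrapT => /eqP ci; apply: ni; exists i.
  pose t : 'rV_N.+1 := ((1 - a 0 0) / c i 0) *: delta_mx 0 i.
  have tc : a + t *m c = 1%:M.
    rewrite -scalemxAl -rowE; apply/matrixP => j k; rewrite !ord1 !mxE.
    by rewrite divfK // addrC subrK.
  have [] := up _ _ _ _ t uu; rewrite tc => <-.
  exact: clear1.
rewrite -(submxK u).
move: (ulsubmx u) (ursubmx u) (dlsubmx u) (drsubmx u) => a b c D uu.
have [c0|c0] := eqVneq c 0; last exact: clear_col.
have a0 : a 0 0 != 0.
  by move: uu; rewrite c0 unitmxE det_ublock det_mx11 unitrM unitfE => /andP[].
(* The corner is nonzero but nothing below it is; adding the top row to the next one creates the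
   entry needed. *)
have [] := down _ _ _ _ (delta_mx 0 0) uu => <-; apply: clear_col.
rewrite c0 add0r; apply: contra_neq a0 => /matrixP/(_ 0 0).
by rewrite !mxE big_ord_recl big_ord0 mxE !eqxx mul1r addr0 => ->.
Qed.

Lemma transvection_invariant_block (X : Type) N (f : 'M[K]_(1 + N) -> X) :
  transvection_invariant f -> transvection_invariant (fun w => f (block_mx 1%:M 0 0 w)).
Proof.
move=> invf T w TT uw; pose T' : 'M[K]_(1 + N) := block_mx 0 0 0 T.
have TT' : T' *m T' = 0.
  by rewrite /T' mulmx_block TT !mulmx0 !mul0mx !addr0; apply: block_mx0.
rewrite -(invf _ (block_mx 1%:M 0 0 w) TT').
  congr f; rewrite /T' [RHS]mulmxDl mul1mx mulmx_block !mulmx0 !mul0mx !addr0.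
  by rewrite add_block_mx !addr0 !add0r mulmxDl mul1mx.
by rewrite unitmxE det_ublock det1 mul1r -unitmxE.
Qed.

End Transvections.

(** * Polynomials without zeros off the leading minor *)

Section NonvanishingPolynomials.
Variable K : closedFieldType.

Lemma meval_line_const a b (A : {mpoly K[a * b]}) (u w : 'M[K]_(a, b)) :
  (forall s, A.@[mxvec (u + s *: w) 0] != 0) -> A.@[mxvec (u + w) 0] = A.@[mxvec u 0].
Proof.
pose l k := (mxvec u 0 k)%:P + (mxvec w 0 k)%:P * 'X : {poly K}.
have lE s : (mpoly_subst_poly l A).[s] = A.@[mxvec (u + s *: w) 0].
  rewrite horner_mpoly_subst_poly; apply: meval_eq => k; rewrite !hornerE.
  by rewrite linearD linearZ !mxE /= mulrC.
move=> A0; have := @nonvanishing_poly_const _ (mpoly_subst_poly l A) _ 1 0.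
by rewrite !lE scale1r scale0r addr0; apply=> s; rewrite lE.
Qed.

(** det(1 + sT) is a polynomial in s without roots, hence equal to its value 1 at s = 0. *)
Lemma det_square_zero N (T : 'M[K]_N) : T *m T = 0 -> \det (1%:M + T) = 1.
Proof.
move=> TT; pose p : {poly K} := \det (1%:M + 'X *: map_mx polyC T).
have pE s : p.[s] = \det (1%:M + s *: T).
  rewrite -horner_evalE -det_map_mx; congr (\det _); apply/matrixP => i j.
  by rewrite !mxE /= horner_evalE !hornerE; case: (_ == _); rewrite ?hornerC.
have := @nonvanishing_poly_const _ p _ 1 0.
rewrite !pE scale1r scale0r addr0 det1; apply=> s.
by rewrite pE -unitfE -unitmxE unitmx_square_zero // -scalemxAl -scalemxAr TT !scaler0.
Qed.

(** Splitting off a 1 at each step ends at the diagonal matrix with entries 1, ..., 1, det u. *)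
Lemma transvection_invariant_det (X : Type) N (f : 'M[K]_N.+1 -> X) u :
  transvection_invariant f -> u \in unitmx ->
  f u = f (scale_row ord_max (\det u) 1%:M).
Proof.
elim: N f u => [|N IH] f u invf uu.
  congr f; apply/matrixP => i j; rewrite !ord1 !mxE det_mx11.
  by rewrite !eqxx expr1 mulr1.
(* Pairing [f] with the determinant, itself invariant, keeps track of the determinant through the
   reduction. *)
pose g := fun u => (f u, \det u).
have [|D uD [fE detE]] := @transvection_reduction K _ N g u _ uu.
  by move=> T w TT uw; rewrite /g invf // det_mulmx det_square_zero // mul1r.
pose blk (w : 'M[K]_N.+1) : 'M[K]_(1 + N.+1) := block_mx 1%:M 0 0 w.
have det_blk w : \det (blk w) = \det w by rewrite det_ublock det1 mul1r.
have {}detE : \det u = \det D := etrans detE (det_blk D).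
rewrite fE -/(blk D) (IH (fun w => f (blk w))) //.
  congr f; rewrite /blk detE.
  apply/matrixP => i j; rewrite [RHS]mxE [X in _ = _ * X]mxE -!val_eqE /=.
  case: (@split_ordP 1 N.+1 i) => i' ->; case: (@split_ordP 1 N.+1 j) => j' ->.
  - by apply: (etrans (block_mxEul _ _ _ _ _ _)); rewrite !ord1 !mxE /= expr0 mul1r.
  - by apply: (etrans (block_mxEur _ _ _ _ _ _)); rewrite !ord1 !mxE /= mulr0.
  - by apply: (etrans (block_mxEdl _ _ _ _ _ _)); rewrite !ord1 !mxE /= mulr0.
  - by apply: (etrans (block_mxEdr _ _ _ _ _ _)); rewrite !mxE -!val_eqE /= !add1n !eqSS.
exact: transvection_invariant_block.
Qed.

Variables (n m : nat).
Hypothesis mn : (m <= n)%N.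
Implicit Types (A B : {mpoly K[m.+1 * n.+1]}) (u : 'M[K]_(m.+1, n.+1)).

Definition nonvanishing_off_lead_minor A :=
  forall u, \det (lead_cols m.+1 u) != 0 -> A.@[mxvec u 0] != 0.

Let standard d : 'M[K]_(m.+1, n.+1) := ext_cols n (scale_row ord_max d 1%:M).

(** Such an [A] is constant on every line that stays off the zeros of the minor. One such line
    removes the columns beyond the leading block; lines of transvections then reduce that block, so
    the value of [A] depends on the minor alone. *)
Lemma meval_nonvanishing A u : nonvanishing_off_lead_minor A ->
  \det (lead_cols m.+1 u) != 0 ->
  A.@[mxvec u 0] = A.@[mxvec (standard (\det (lead_cols m.+1 u))) 0].
Proof.
move=> A0 detu; pose w := lead_cols m.+1 u.
have leadD (v v' : 'M[K]_(m.+1, n.+1)) s :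
    lead_cols m.+1 (v + s *: v') = lead_cols m.+1 v + s *: lead_cols m.+1 v'.
  by apply/matrixP => i j; rewrite !mxE.
have leadB (v v' : 'M[K]_(m.+1, n.+1)) :
    lead_cols m.+1 (v - v') = lead_cols m.+1 v - lead_cols m.+1 v'.
  by apply/matrixP => i j; rewrite !mxE.
transitivity A.@[mxvec (ext_cols n w) 0].
  rewrite -[ext_cols n w](subrK u) addrC; apply/esym/meval_line_const => s.
  by apply: A0; rewrite leadD leadB ext_colsK // subrr scaler0 addr0.
pose f (w : 'M[K]_m.+1) := A.@[mxvec (ext_cols n w) 0].
rewrite -[LHS]/(f w) -[RHS]/(f (scale_row ord_max (\det w) 1%:M)).
apply: transvection_invariant_det; last by rewrite unitmxE unitfE.
move=> T v TT uv; rewrite /f mulmxDl mul1mx.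
have -> : ext_cols n (v + T *m v) = ext_cols n v + ext_cols n (T *m v).
  by apply/matrixP => i j; rewrite !mxE; case: ifP; rewrite ?addr0 // !mxE.
apply: meval_line_const => s; apply: A0.
rewrite leadD !ext_colsK // scalemxAl -[X in X + _]mul1mx -mulmxDl.
rewrite -unitfE -unitmxE unitmx_mul uv andbT unitmx_square_zero //.
by rewrite -scalemxAl -scalemxAr TT !scaler0.
Qed.

Lemma lead_minor_dense A B :
  (forall u, \det (lead_cols m.+1 u) != 0 -> A.@[mxvec u 0] = B.@[mxvec u 0]) -> A = B.
Proof.
move=> eqAB; apply/eqP; rewrite -subr_eq0.
have : (A - B) * lead_minor K n m.+1 == 0.
  apply/eqP/eq_mpoly_mxvec => u; rewrite mevalM mevalB meval0 meval_lead_minor.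
  have [->|detu] := eqVneq (\det (lead_cols m.+1 u)) 0; first by rewrite mulr0.
  by rewrite eqAB // subrr mul0r.
by rewrite mulf_eq0 (negPf (lead_minor_neq0 _ _)) ?orbF.
Qed.

(** The standard matrix of determinant t is the one of determinant 1 with its last row scaled by t,
    and degree d in that row gives the factor t^d. *)
Lemma nonvanishing_multihomogeneous d A : nonvanishing_off_lead_minor A ->
  multihomogeneous d A -> exists2 c, c != 0 & A = c *: lead_minor K n m.+1 ^+ d.
Proof.
move=> A0 hA; exists A.@[mxvec (ext_cols n 1%:M) 0].
  by apply: A0; rewrite ext_colsK // det1 oner_neq0.
apply: lead_minor_dense => u detu; rewrite (meval_nonvanishing A0 detu).
rewrite mevalZ rmorphXn /= meval_lead_minor mulrC.
rewrite -((multihomogeneousP d A).1 hA ord_max); congr (A.@[mxvec _ 0]).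
by apply/matrixP => i j; rewrite !mxE; case: ifP; rewrite ?mulr0 // mxE.
Qed.

(** Both factors have no zeros off the minor, so they are functions of the minor. Restricted to the
    standard matrices, the factorization becomes one of 'X, where one factor is constant. *)
Lemma irreducible_lead_minor : irreducible_mpoly (lead_minor K n m.+1).
Proof.
split=> [|A B AB].
  apply/negP => /mulrV /(congr1 (meval (mxvec (0 : 'M[K]_(m.+1, n.+1)) 0))).
  rewrite mevalM meval1 meval_lead_minor (_ : lead_cols _ 0 = 0) ?det0 ?mul0r.
    by move/eqP; rewrite eq_sym oner_eq0.
  by apply/matrixP => i j; rewrite !mxE.
have minorE u : \det (lead_cols m.+1 u) = A.@[mxvec u 0] * B.@[mxvec u 0].
  by rewrite -mevalM -AB meval_lead_minor.
have A0 : nonvanishing_off_lead_minor A.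
  by move=> u; rewrite minorE mulf_eq0 negb_or => /andP[].
have B0 : nonvanishing_off_lead_minor B.
  by move=> u; rewrite minorE mulf_eq0 negb_or => /andP[].
(* [standard] is affine in its parameter, so this line runs through exactly the standard
   matrices. *)
pose l k := (mxvec (standard 0) 0 k)%:P + (mxvec (standard 1 - standard 0) 0 k)%:P * 'X : {poly K}.
have lE (C : {mpoly K[m.+1 * n.+1]}) d :
    (mpoly_subst_poly l C).[d] = C.@[mxvec (standard d) 0].
  rewrite horner_mpoly_subst_poly; apply: meval_eq => k; rewrite !hornerE.
  case/mxvec_indexP: k => i j; rewrite !mxvecE !mxE; case: ifP => _; last first.
    by rewrite subrr mul0r addr0.
  by case: (i == ord_max); rewrite ?expr0 ?expr1 ?expr0n; ring.
have det_std d : \det (lead_cols m.+1 (standard d)) = d.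
  rewrite ext_colsK //; have := lead_cols_scale_row 1 (ord_max : 'I_m.+1) d (1%:M : 'M[K]_(m.+1)).
  rewrite !expr1 (_ : lead_cols m.+1 1%:M = 1%:M); last first.
    by apply/matrixP => i j; rewrite !mxE inord_val.
  rewrite det1 mulr1 => {2}<-; congr (\det _).
  by apply/matrixP => i j; rewrite !mxE inord_val.
have pq : mpoly_subst_poly l A * mpoly_subst_poly l B = 'X.
  apply/eqP; rewrite -subr_eq0; apply/eqP/poly_eq0_horner => d.
  by rewrite hornerD hornerM !lE -minorE det_std hornerN hornerX subrr.
have unit_const C c : nonvanishing_off_lead_minor C ->
    mpoly_subst_poly l C = c%:P -> C \is a GRing.unit.
  move=> C0 Cc; have CE : C = c%:MP.
    by apply: lead_minor_dense => u detu; rewrite meval_nonvanishing // -lE Cc hornerC mevalC.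
  have c0 : c != 0.
    have := C0 (standard 1); rewrite det_std oner_neq0 CE mevalC; exact.
  by apply/unitrP; exists (c^-1)%:MP; rewrite CE -!mpolyCM mulVf // mulfV // mpolyC1.
have p0 : mpoly_subst_poly l A != 0.
  by apply: contra_eq_neq pq => ->; rewrite mul0r eq_sym polyX_eq0.
have q0 : mpoly_subst_poly l B != 0.
  by apply: contra_eq_neq pq => ->; rewrite mulr0 eq_sym polyX_eq0.
have := congr1 (fun p : {poly K} => size p) pq; rewrite size_mul // size_polyX.
have [/eqP/size_poly1P[c _ /unit_const]|sA] := eqVneq (size (mpoly_subst_poly l A)) 1%N.
  by move/(_ A0); left.
have [/eqP/size_poly1P[c _ /unit_const]|sB] := eqVneq (size (mpoly_subst_poly l B)) 1%N.
  by move/(_ B0); right.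
move: p0 q0 sA sB; rewrite -!size_poly_gt0.
by case: (size _) => [|[|a]] //; case: (size _) => [|[|b]] //; rewrite !addSn !addnS.
Qed.

(** The witness is the standard plane with multiplicity [d]; for d = 0 it contributes the form 1. *)
Lemma chow_cycle_lead_minor d : chow_cycle d (lead_minor K n m.+1 ^+ d).
Proof.
split; first exact: multihomogeneous_lead_minor.
exists (@Cycle K n 1 (fun=> flag m) (fun=> d)); split=> /=.
- by move=> i /=; split; [exact: irreducible_flag|exact: has_dim_flag].
- by exists (fun=> 1%N) => [i|]; [exact: has_degree_flag|rewrite big_ord1 muln1].
exists (fun=> lead_minor K n m.+1) => [i|]; last by rewrite big_ord1.
split; first exact: irreducible_lead_minor.
by move=> u; apply: chow_zero_lead_minor.
Qed.

(** A zero of [G] gives a point of the support on the linear space; the support lies in the plane,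
    so the minor vanishes there too. *)
Lemma fixed_chow_cycle d (G : {mpoly K[m.+1 * n.+1]}) : chow_cycle d G ->
  (forall (i k : 'I_n.+1) t, (i < k)%N -> exists2 c, c != 0 & act (root_elt i k t) G = c *: G) ->
  exists2 c, c != 0 & G = c *: lead_minor K n m.+1 ^+ d.
Proof.
move=> [hG [Z [effZ _ GZ]]] fixG; apply: nonvanishing_multihomogeneous => // u detu.
have supp := fixed_cycle_support effZ GZ fixG.
have [g gZ ->] := GZ; rewrite rmorph_prod; apply/prodf_neq0 => i _.
have [->|i0] := eqVneq (mult i) 0%N; first by rewrite expr0 rmorph1 oner_neq0.
rewrite rmorphXn /= expf_neq0 //; apply/eqP => /(gZ i).2 [x [Vx ux]]; case/eqP: detu.
rewrite -meval_lead_minor; apply/(@chow_zero_lead_minor _ _ _ u mn); exists x; split=> //.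
by apply: supp Vx; rewrite lt0n.
Qed.

End NonvanishingPolynomials.

(** * The Frobenius and rational forms *)

Section Frobenius.
Variables (K : closedFieldType) (Q : nat).
Hypothesis natQ : [pchar K].-nat Q.
Hypothesis Q_gt1 : (1 < Q)%N.

Definition frob of [pchar K].-nat Q := fun x : K => x ^+ Q.

Lemma frob_is_nmod_morphism : nmod_morphism (frob natQ).
Proof.
split; first by rewrite /frob expr0n gtn_eqF // ltnW.
by move=> x y; rewrite /frob exprDn_pchar.
Qed.

Lemma frob_is_monoid_morphism : monoid_morphism (frob natQ).
Proof.
by split; [rewrite /frob expr1n|move=> x y; rewrite /frob exprMn].
Qed.

Definition frobenius : {rmorphism K -> K} :=
  HB.pack (frob natQ) (GRing.isNmodMorphism.Build _ _ (frob natQ) frob_is_nmod_morphism)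
    (GRing.isMonoidMorphism.Build _ _ (frob natQ) frob_is_monoid_morphism).

Lemma frobeniusE x : frobenius x = x ^+ Q. Proof. by []. Qed.

Lemma meval_frobenius N (G : {mpoly K[N]}) v :
  (map_mpoly frobenius G).@[fun i => v i ^+ Q] = G.@[v] ^+ Q.
Proof.
rewrite -frobeniusE; elim/mpolyind: G => [|c m p _ _ IH]; first by rewrite !rmorph0.
have -> : map_mpoly frobenius (c *: 'X_[m] + p) = frobenius c *: 'X_[m] + map_mpoly frobenius p.
  by have := map_mpolyZ frobenius c 'X_[m]; rewrite map_mpolyX => <-; apply: raddfD.
rewrite !mevalD IH rmorphD.
rewrite !mevalZ !mevalX rmorphM rmorph_prod; congr (_ * _ + _).
by apply: eq_bigr => i _; rewrite rmorphXn.
Qed.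

Lemma exists_Qth_root (x : K) : exists y, y ^+ Q = x.
Proof.
have : size ('X^Q - x%:P : {poly K}) != 1%N.
  by rewrite size_XnsubC ?eqSS -?lt0n // ltnW.
by case/closed_rootP => y; rewrite rootE !hornerE subr_eq0 => /eqP; exists y.
Qed.

Definition rational_form N (G : {mpoly K[N]}) := forall mu : 'X_{1..N}, G@_mu ^+ Q = G@_mu.

(** Rationality of the coefficients becomes an identity between values. In the converse direction
    every point is the Frobenius image of another, since Q-th roots exist. *)
Lemma rational_formP N (G : {mpoly K[N]}) :
  rational_form G <-> forall v, G.@[fun i => v i ^+ Q] = G.@[v] ^+ Q.
Proof.
have mapG : rational_form G <-> map_mpoly frobenius G = G.
  split=> [rG|mG mu]; last by rewrite -[in RHS]mG mcoeff_map_mpoly.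
  by apply/mpolyP => mu; rewrite mcoeff_map_mpoly; exact: rG.
rewrite mapG; split=> [{1}<- v|eqG]; first exact: meval_frobenius.
apply: eq_mpoly_meval => v.
have /choice[w wv] i := exists_Qth_root (v i).
have -> : v = fun i => w i ^+ Q by apply/funext => i; rewrite wv.
by rewrite meval_frobenius eqG.
Qed.

(* X^Q - X - c is separable, its derivative being -1 *)
Lemma Artin_Schreier_roots (c : K) : exists s : seq K,
  [/\ uniq s, size s = Q & forall t, (t \in s) = (t ^+ Q - t == c)].
Proof.
pose p : {poly K} := 'X^Q - 'X - c%:P.
have szQ : (size ('X + c%:P : {poly K})%R < size ('X^Q : {poly K})%R)%N.
  by rewrite size_XaddC size_polyXn !ltnS.
have pE : p = 'X^Q - ('X + c%:P) by rewrite /p opprD addrA.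
have szp : size p = Q.+1.
  by rewrite pE size_polyDl ?size_polyXn // size_polyN -[Q.+1](size_polyXn K).
have lcp : lead_coef p = 1 by rewrite pE lead_coefDl ?lead_coefXn // size_polyN.
have [s] := closed_field_poly_normal p; rewrite lcp scale1r => ps.
exists s; split.
- rewrite -separable_prod_XsubC -ps separable_poly.unlock.
  have Q0 : Q%:R = 0 :> K.
    have pr : pdiv Q \in [pchar K].
      by apply: (pnatP _ (ltnW Q_gt1) natQ); rewrite ?pdiv_prime ?pdiv_dvd.
    have /dvdnP[k ->] := pdiv_dvd Q.
    by rewrite natrM (pcharf0 pr) mulr0.
  have -> : p^`() = -1.
    by rewrite /p !derivB derivXn derivX derivC subr0 -scaler_nat Q0 scale0r sub0r.
  by apply/Bezout_eq1_coprimepP; exists (0, -1); rewrite /= mul0r add0r mulrNN mulr1.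
- by have := congr1 (fun q : {poly K} => size q) ps; rewrite szp size_prod_XsubC => -[].
- move=> t; rewrite -root_prod_XsubC -ps rootE !hornerE; by rewrite subr_eq0.
Qed.

End Frobenius.

(** * Counting rational points under an additive group action *)

Section AdditiveGroupAction.
Variables (K : closedFieldType) (Q : nat).
Hypothesis natQ : [pchar K].-nat Q.
Hypothesis Q_gt1 : (1 < Q)%N.
Variables (T : choiceType) (R : set T) (a : K -> T -> T).
Hypothesis a0 : forall x, a 0 x = x.
Hypothesis aD : forall s t x, a (s + t) x = a s (a t x).
(** Compatibility with the Frobenius: it sends [a t x] to [a (t ^+ Q) x] when x is rational, and
    rational means fixed. The set [R] need not be stable under the action. *)
Hypothesis aR : forall x t, R x -> (R (a t x) <-> a (t ^+ Q) x = a t x).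
Hypothesis closed_stab : forall x, R x -> (forall t, a t x = x) \/
  exists2 p : {poly K}, p != 0 & forall t, a t x = x -> root p t.

Lemma act_eq_sub s t x : a s x = a t x <-> a (s - t) x = x.
Proof.
split=> [eq_st|eqx]; last by rewrite -{2}eqx -aD addrC subrK.
by rewrite addrC aD eq_st -aD addNr a0.
Qed.

Lemma finite_stab x : R x -> (exists t, a t x <> x) ->
  exists2 h : seq K, uniq h & forall t, (t \in h) = (a t x == x).
Proof.
move=> Rx [t0 nfix]; case: (closed_stab Rx) => [/(_ t0)//|[p p0 pr]].
have [r pE] := closed_field_poly_normal p.
exists (undup [seq t <- r | a t x == x]); first exact: undup_uniq.
move=> t; rewrite mem_undup mem_filter; case: eqP => //= /pr.
by rewrite pE rootZ ?lead_coef_eq0 // root_prod_XsubC.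
Qed.

(* The rational points of the orbit of [x] are [L^-1(H)/H], where [H] is the
   stabilizer and [L t = t^Q - t] is surjective with kernel of order [Q]. *)
Lemma size_rational_orbit x (c : seq T) : R x -> (exists t, a t x <> x) -> uniq c ->
  (forall y, (y \in c) <-> R y /\ exists t, y = a t x) -> size c = Q.
Proof.
move=> Rx nfix uniq_c cP; have [h uniq_h hP] := finite_stab Rx nfix.
have h0 : (0 < size h)%N.
  by have : 0 \in h; [rewrite hP a0|case: (h)].
have /choice[rt rtP] (b : K) := Artin_Schreier_roots natQ Q_gt1 b.
pose L := flatten (map rt h).
have LP t : (t \in L) = (a (t ^+ Q - t) x == x).
  rewrite -hP; apply/flatten_mapP/idP => [[b bh]|th].
    by have [_ _ ->] := rtP b => /eqP->.
  by exists (t ^+ Q - t) => //; have [_ _ ->] := rtP (t ^+ Q - t).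
have Lc t : t \in L -> a t x \in c.
  rewrite LP => /eqP/act_eq_sub eqt; apply/cP; split; last by exists t.
  exact/aR.
have sizeL : size L = (size h * Q)%N.
  rewrite /L size_flatten /shape -map_comp sumnE big_map.
  rewrite (eq_bigr (fun=> Q)) => [|b _]; last by have [] := rtP b.
  by rewrite big_const_seq count_predT iter_addn_0 mulnC.
have uniqL : uniq L.
  rewrite /L; elim: (h) uniq_h => //= b s IH /andP[nbs us].
  rewrite cat_uniq IH // andbT; have [-> _ _] := rtP b; rewrite /=.
  apply/hasPn => t /flatten_mapP[b' b's]; have [_ _ ->] := rtP b' => /eqP tb'.
  have [_ _ ->] := rtP b; apply: contraNN nbs => /eqP <-.
  by rewrite tb'.
(* The parameters t sending x to y form a coset of the stabilizer, and when y is rational all of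
   them lie in [L]. *)
have fiber y : y \in c -> count (fun t => a t x == y) L = size h.
  move/cP => [Ry [t0 yE]].
  rewrite -size_filter -(size_map (fun s => t0 + s) h); apply/perm_size/uniq_perm.
  - exact: filter_uniq.
  - by rewrite map_inj_uniq //; apply: addrI.
  move=> t; rewrite mem_filter; apply/andP/mapP => [[/eqP atx _]|[s sh ->]].
    by exists (t - t0); [rewrite hP; apply/eqP/act_eq_sub; rewrite atx|rewrite addrC subrK].
  have eqy : a (t0 + s) x = y.
    by rewrite aD; move: sh; rewrite hP => /eqP ->.
  split; first exact/eqP.
  rewrite LP; apply/eqP/act_eq_sub; apply/aR => //.
  by rewrite eqy.
(* Second count of [L], along the fibers of t |-> a t x; the first one sums over the Q preimages of
   each element of [h]. *)
have : size L = (size c * size h)%N.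
  rewrite -sum1_size.
  transitivity (\sum_(t <- L) \sum_(y <- c) (a t x == y : nat))%N.
    rewrite big_seq [RHS]big_seq; apply: eq_bigr => t /Lc tc.
    rewrite (bigD1_seq (a t x)) //= eqxx big1 // => y; rewrite eq_sym => /negPf -> //.
  rewrite exchange_big /= (eq_big_seq (fun=> size h)).
    by rewrite big_const_seq count_predT iter_addn_0 mulnC.
  by move=> y /fiber <-; rewrite -sum1_count [RHS]big_mkcond /=; apply: eq_bigr => t _; case: eqP.
by rewrite sizeL mulnC => /eqP; rewrite eqn_pmul2r // => /eqP.
Qed.

(** The rational parts of the orbits are removed one at a time, Q elements each. *)
Lemma dvdn_size_nonfixed (s : seq T) : uniq s ->
  (forall x, x \in s -> R x /\ exists t, a t x <> x) ->
  (forall x t, x \in s -> R (a t x) -> a t x \in s) -> (Q %| size s)%N.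
Proof.
have [k] := ubnP (size s); elim: k s => // k IH [|x s'] //.
set s := x :: s' => sk uniq_s sP sR.
have xs : x \in s by rewrite inE eqxx.
have [Rx nfix] := sP x xs.
pose orb y := `[< exists t, y = a t x >].
have size_orb : size (filter orb s) = Q.
  apply: (size_rational_orbit Rx nfix); first exact: filter_uniq.
  move=> y; rewrite mem_filter; split=> [/andP[/asboolP yx ys]|[Ry [t yE]]].
    by split=> //; have [] := sP y ys.
  by apply/andP; split; [apply/asboolP; exists t|rewrite yE; apply: sR; rewrite -?yE].
rewrite -(count_predC orb s) -!size_filter size_orb dvdn_addr ?dvdnn //.
apply: IH; last first.
- move=> y t; rewrite !mem_filter => /andP[/= ny ys] Ry; rewrite (sR y t ys Ry) andbT /=.
  apply: contraNN ny => /asboolP[u eqy]; apply/asboolP; exists (- t + u).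
  by rewrite aD -eqy -aD addNr a0.
- by move=> y; rewrite mem_filter => /andP[_]; apply: sP.
- exact: filter_uniq.
suff lt : (size (filter (predC orb) s) < size s)%N by apply: leq_trans lt _.
rewrite -[X in (_ < X)%N](count_predC orb s) -!size_filter size_orb.
by rewrite -[X in (X < _)%N]add0n ltn_add2r ltnW.
Qed.

Lemma card_uniq_seq (s : seq T) : uniq s -> ([set` s] #= `I_(size s))%card.
Proof.
case: s => [|x0 s'] uniq_s.
  rewrite (_ : [set` [::]] = set0); last by apply/seteqP; split.
  by rewrite II0.
set s := x0 :: s' in uniq_s *.
have -> : [set` s] = nth x0 s @` `I_(size s).
  apply/seteqP; split=> x /=; last by move=> [i ilt <-]; apply: mem_nth.
  by move=> xs; exists (index x s); [rewrite -index_mem in xs|rewrite nth_index].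
apply: inj_card_eq => i j; rewrite !inE /= => il jl /eqP.
by rewrite nth_uniq // => /eqP.
Qed.

Lemma card_fixed_points N : (R #= `I_N)%card ->
  exists2 N', ([set x | R x /\ forall t, a t x = x] #= `I_N')%card & N = N' %[mod Q].
Proof.
move=> cardR.
have /finite_seqP[s0 RE] : finite_set R by apply/finite_setP; exists N.
pose s := undup s0.
have sP x : (x \in s) <-> R x by rewrite mem_undup RE.
have uniq_s : uniq s by exact: undup_uniq.
have sizeN : size s = N.
  apply/card_eq_II; apply: card_eq_trans cardR; rewrite card_eq_sym.
  suff -> : R = [set` s] by apply: card_uniq_seq.
  by apply/seteqP; split=> x /= /sP.
pose fixed x := `[< forall t, a t x = x >].
exists (size (filter fixed s)).
  suff -> : [set x | R x /\ forall t, a t x = x] = [set` filter fixed s].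
    by apply: card_uniq_seq; apply: filter_uniq.
  apply/seteqP; split=> x /=; rewrite mem_filter.
    by move=> [/sP -> fx]; rewrite andbT; apply/asboolP.
  by move=> /andP[/asboolP fx /sP].
rewrite -sizeN -(count_predC fixed s) -!size_filter.
have /dvdnP[k ->] : (Q %| size (filter (predC fixed) s))%N.
  apply: dvdn_size_nonfixed.
  - exact: filter_uniq.
  - move=> x; rewrite mem_filter => /andP[/= /asboolPn nx /sP Rx]; split=> //.
    by apply: contrapT => nt; apply: nx => t; apply: contrapT => nfix; apply: nt; exists t.
  - move=> x t; rewrite !mem_filter => /andP[/= nx xs] /sP ->; rewrite andbT.
    apply: contraNN nx => /asboolP fx; apply/asboolP => u.
    (* If a translate of x is fixed by everything, so is x, the group being commutative. *)
    have /(congr1 (a (- t))) := fx u; rewrite -!aD addNr a0 => fxu.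
    by rewrite -[RHS]fxu; congr (a _ x); ring.
by rewrite addnC modnMDl.
Qed.

End AdditiveGroupAction.

(** * Relations between root subgroups *)

Section RootElements.
Variables (K : closedFieldType) (n : nat).
Implicit Types (i j k l : 'I_n.+1) (s t : K).

Lemma mul_delta_mx i j k l :
  delta_mx i j *m delta_mx k l = (j == k)%:R *: delta_mx i l :> 'M[K]_n.+1.
Proof. by rewrite mul_delta_mx_cond scaler_nat. Qed.

Lemma mul_root_elt i k j l s t : root_elt i k s *m root_elt j l t =
  1%:M + s *: delta_mx i k + t *: delta_mx j l + ((k == j)%:R * (s * t)) *: delta_mx i l.
Proof.
rewrite /root_elt mulmxDl mul1mx mulmxDr mulmx1 -scalemxAl -scalemxAr mul_delta_mx.
by rewrite !scalerA mulrC [s * t]mulrC -!addrA; congr (_ + _); rewrite addrCA mulrA.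
Qed.

Lemma root_elt0 i k : root_elt i k 0 = 1%:M :> 'M[K]_n.+1.
Proof. by rewrite /root_elt scale0r addr0. Qed.

Lemma root_eltD i k s t : (i < k)%N ->
  root_elt i k (s + t) = root_elt i k s *m root_elt i k t.
Proof.
move=> ik; rewrite mul_root_elt; have -> : (k == i) = false by rewrite -val_eqE /= gtn_eqF.
by rewrite mul0r scale0r addr0 /root_elt scalerDl addrA.
Qed.

Lemma unit_root_elt i k t : (i < k)%N -> root_elt i k t \in unitmx.
Proof.
move=> ik; have : root_elt i k t *m root_elt i k (- t) = 1%:M.
  by rewrite -root_eltD // subrr root_elt0.
by case/mulmx1_unit.
Qed.

Lemma root_elt_commute i k j l s t : l != i -> j != k ->
  root_elt j l s *m root_elt i k t = root_elt i k t *m root_elt j l s.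
Proof.
move=> /negPf li /negPf jk; rewrite !mul_root_elt li [k == j]eq_sym jk !mul0r !scale0r !addr0.
exact: addrAC.
Qed.

(** The commutator relation, arranged with the (i,k) element leftmost: the two factors next to a
    point on the right then have column [l], and those fix it in the application. *)
Lemma root_elt_commutator i k l s t : i != k -> l != i -> l != k ->
  root_elt k l s *m root_elt i k t =
  root_elt i k t *m (root_elt k l s *m root_elt i l (- (t * s))).
Proof.
move=> /negPf ik /negPf li /negPf lk.
rewrite mulmxA !mul_root_elt eqxx li !mul0r scale0r addr0 mul1r.
rewrite [root_elt i l _]/root_elt mulmxDr mulmx1 -scalemxAr.
rewrite !mulmxDl -!scalemxAl mul1mx !mul_delta_mx li [k == i]eq_sym ik.
rewrite !scale0r !scaler0 !addr0 -[RHS]addrA scaleNr subrr addr0.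
exact: addrAC.
Qed.

Lemma map_root_elt (f : {rmorphism K -> K}) i k t :
  map_mx f (root_elt i k t) = root_elt i k (f t).
Proof.
by apply/matrixP => a b; rewrite !mxE rmorphD rmorphM !rmorph_nat.
Qed.

End RootElements.

(** * Homogeneous coordinates *)

Section ProjectivePoints.
Variables (K : closedFieldType) (W : lmodType K).
Implicit Types (v w : W) (c : K).

Lemma proj_pointZ c w : c != 0 -> proj_point (c *: w) = proj_point w.
Proof.
move=> c0; apply/seteqP; split=> _ [b b0 <-].
  by exists (b * c); [rewrite /= mulf_neq0|rewrite scalerA].
by exists (b / c); [rewrite /= mulf_neq0 ?invr_eq0|rewrite scalerA divfK].
Qed.

Lemma mem_proj_point w : proj_point w w.
Proof. by exists 1; [exact: oner_neq0|rewrite scale1r]. Qed.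

Lemma proj_point_eqP v w : proj_point v = proj_point w <-> exists2 c, c != 0 & v = c *: w.
Proof.
split=> [eqP|[c c0 ->]]; last exact: proj_pointZ.
by have := mem_proj_point v; rewrite eqP => -[c c0 <-]; exists c.
Qed.

End ProjectivePoints.

(** * The unipotent group on rational Chow points *)

Section RationalChowPoints.
Variables (K : closedFieldType) (n m d Q : nat).
Hypothesis mn : (m <= n)%N.
Hypothesis natQ : [pchar K].-nat Q.
Hypothesis Q_gt1 : (1 < Q)%N.

Local Notation N := (m.+1 * n.+1)%N.
Local Notation form := {mpoly K[N]}.
Local Notation point := (set form).
Local Notation X := (rational_points Q (chow_variety K n m d)).
Implicit Types (G H : form) (x y : point) (M : 'M[K]_n.+1).
Implicit Types (i j k l : 'I_n.+1) (s t : K).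

Definition act_point M (x : point) : point := [set act M G | G in x].

Lemma act_point_proj M G : act_point M (proj_point G) = proj_point (act M G).
Proof.
apply/seteqP; split=> [_ [_ [c c0 <-] <-]|_ [c c0 <-]].
  by exists c => //; rewrite actZ.
by exists (c *: G); [exists c|rewrite actZ].
Qed.

Lemma act_point1 x : act_point 1%:M x = x.
Proof.
apply/seteqP; split=> [_ [G xG <-]|G xG]; first by rewrite act1.
by exists G => //; rewrite act1.
Qed.

Lemma act_pointM M M' x : act_point (M *m M') x = act_point M (act_point M' x).
Proof.
apply/seteqP; split=> [_ [G xG <-]|_ [_ [G xG <-] <-]].
  by rewrite -actA; exists (act M' G) => //; exists G.
by rewrite actA; exists G.
Qed.

Lemma chow_cycle_neq0 G : chow_cycle d G -> G != 0.
Proof.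
move=> [_ [Z [_ _ [g gZ ->]]]]; apply/prodf_neq0 => i _; apply: expf_neq0.
apply/eqP => gi0; have [[nu irr] _] := gZ i.
have [] := irr 0 0; rewrite ?mul0r ?gi0 // => u0;
  by move: nu; rewrite gi0 u0.
Qed.

Lemma rational_pointP x : X x <-> exists G, [/\ chow_cycle d G, x = proj_point G &
  exists2 H, rational_form Q H & x = proj_point H].
Proof.
split=> [[[G hG <-] [H [c c0 <-] rH]]|[G [hG -> [H rH eqGH]]]].
  by exists G; split=> //; exists (c *: G); rewrite ?proj_pointZ.
split; first by exists G.
by exists H => //; rewrite eqGH; exact: mem_proj_point.
Qed.

(** As [H] is rational, the Frobenius conjugate of its translate by t is its translate by t^Q. A
    class equal to its conjugate has rational coordinates, obtained by making one nonzero
    coefficient equal to 1. *)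
Lemma rational_translate i k t H : H != 0 -> (i < k)%N -> rational_form Q H ->
  (exists2 H', rational_form Q H' & proj_point (act (root_elt i k t) H) = proj_point H') <->
  proj_point (act (root_elt i k (t ^+ Q)) H) = proj_point (act (root_elt i k t) H).
Proof.
move=> H0 ik rH; pose sigma := frobenius natQ Q_gt1.
have HP (u : 'M[K]_(m.+1, n.+1)) : H.@[mxvec (map_mx sigma u) 0] = H.@[mxvec u 0] ^+ Q.
  rewrite -(rational_formP natQ Q_gt1 H).1 //.
  by apply: meval_eq => l; rewrite -map_mxvec mxE.
have translateP (u : 'M[K]_(m.+1, n.+1)) :
    (act (root_elt i k t) H).@[mxvec u 0] ^+ Q =
    (act (root_elt i k (t ^+ Q)) H).@[mxvec (map_mx sigma u) 0].
  by rewrite !meval_act -HP map_mxM map_root_elt.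
have surj (w : 'M[K]_(m.+1, n.+1)) : exists u, w = map_mx sigma u.
  have /choice[r rP] := exists_Qth_root Q_gt1 (K := K).
  by exists (map_mx r w); apply/matrixP => a b; rewrite !mxE; exact/esym/rP.
set B := act (root_elt i k t) H in translateP *.
have B0 : B != 0 by apply: act_neq0 => //; apply: unit_root_elt.
split=> [[H' rH' /esym/proj_point_eqP[c c0 H'E]]|/proj_point_eqP[c c0 eqB]].
  apply/proj_point_eqP; exists (c / c ^+ Q).
    by rewrite mulf_neq0 ?invr_eq0 ?expf_neq0.
  apply: eq_mpoly_mxvec => w; have [u ->] := surj w.
  rewrite -translateP mevalZ.
  have : H'.@[mxvec (map_mx sigma u) 0] = H'.@[mxvec u 0] ^+ Q.
    rewrite -(rational_formP natQ Q_gt1 H').1 //.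
    by apply: meval_eq => l; rewrite -map_mxvec mxE.
  rewrite H'E !mevalZ exprMn mulrAC => ->.
  by rewrite mulrAC divff ?mul1r ?expf_neq0.
have [mu muB] : exists mu, B@_mu != 0.
  by exists (mlead B); rewrite mleadc_eq0.
have mapB : map_mpoly sigma B = c *: B.
  apply: eq_mpoly_mxvec => w; have [u ->] := surj w.
  rewrite -eqB -translateP -(meval_frobenius natQ Q_gt1).
  by apply: meval_eq => l; rewrite -map_mxvec mxE.
have coefB nu : B@_nu ^+ Q = c * B@_nu.
  by rewrite -mcoeffZ -mapB mcoeff_map_mpoly.
(* All coefficients of [B] satisfy b^Q = c b with the same c, so their ratios are fixed by the
   Frobenius. *)
exists ((B@_mu)^-1 *: B); last by rewrite proj_pointZ // invr_eq0.
move=> nu; rewrite mcoeffZ exprMn exprVn !coefB invfM.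
by rewrite mulrACA mulVf // mul1r.
Qed.

(** Two forms are proportional when the 2 by 2 determinants of their values vanish. Comparing with a
    point [v] where [G] is nonzero gives polynomials in t: either one is nonzero and confines the
    stabilizer to its roots, or all vanish and every t stabilizes. *)
Lemma translate_stabilizer i k G : G != 0 -> (i < k)%N ->
  (forall t, proj_point (act (root_elt i k t) G) = proj_point G) \/
  exists2 p : {poly K}, p != 0 &
    forall t, proj_point (act (root_elt i k t) G) = proj_point G -> root p t.
Proof.
move=> G0 ik.
have [v Gv] := mpoly_mxvec_nonroot G0.
pose l (u : 'M[K]_(m.+1, n.+1)) c : {poly K} :=
  (mxvec u 0 c)%:P + (mxvec (u *m delta_mx i k) 0 c)%:P * 'X.
have lE u t : (mpoly_subst_poly (l u) G).[t] = (act (root_elt i k t) G).@[mxvec u 0].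
  rewrite horner_mpoly_subst_poly meval_act; apply: meval_eq => c; rewrite !hornerE.
  by rewrite /root_elt mulmxDr mulmx1 -scalemxAr linearD linearZ !mxE /= mulrC.
pose p u : {poly K} := G.@[mxvec v 0] *: mpoly_subst_poly (l u) G -
  G.@[mxvec u 0] *: mpoly_subst_poly (l v) G.
have pE u t : (p u).[t] = G.@[mxvec v 0] * (act (root_elt i k t) G).@[mxvec u 0] -
    G.@[mxvec u 0] * (act (root_elt i k t) G).@[mxvec v 0].
  by rewrite /p hornerD hornerN !hornerZ !lE.
have [[u pu]|np] := pselect (exists u, p u != 0); [right|left].
  exists (p u) => // t /proj_point_eqP[c c0 actG].
  by rewrite rootE pE actG !mevalZ; apply/eqP; ring.
move=> t; pose B := act (root_elt i k t) G.
have BE : B = (B.@[mxvec v 0] / G.@[mxvec v 0]) *: G.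
  apply: eq_mpoly_mxvec => u; rewrite mevalZ.
  have pu : p u = 0 by apply: contrapT => /eqP pu; apply: np; exists u.
  have := pE u t; rewrite pu horner0 -/B => /esym/eqP; rewrite subr_eq0 => /eqP eqB.
  by rewrite mulrAC [_ * G.@[_]]mulrC -eqB mulrAC divff // mul1r.
apply/proj_point_eqP; exists (B.@[mxvec v 0] / G.@[mxvec v 0]) => //.
have : B != 0 by apply: act_neq0 => //; apply: unit_root_elt.
by apply: contra_neq => c0; rewrite BE c0 scale0r.
Qed.

(** The degree is at most (m+1)d and the coefficients lie among the Q roots of X^Q - X, the
    Artin-Schreier equation with c = 0. *)
Lemma finite_rational_points : finite_set X.
Proof.
have [rs [_ _ rsP]] := Artin_Schreier_roots natQ Q_gt1 (0 : K).
pose B := (m.+1 * d).+1.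
pose phi (f : {ffun 'X_{1..N < B} -> seq_sub rs}) : point :=
  proj_point (\sum_(mu : 'X_{1..N < B}) val (f mu) *: 'X_[mu]).
apply: (@sub_finite_set _ _ (range phi)); last exact/finite_image/finite_finset.
move=> x /rational_pointP[G [[hG _] xG [H rH xH]]].
have rsH mu : H@_mu \in rs by rewrite rsP rH subrr.
exists [ffun mu : 'X_{1..N < B} => SeqSub (rsH mu)] => //.
rewrite xH /phi; congr proj_point; apply/esym.
have szH : (msize H <= B)%N.
  have [c c0 ->] : exists2 c, c != 0 & H = c *: G by apply/proj_point_eqP; rewrite -xH.
  apply: leq_trans (msizeZ_le _ _) _; rewrite msizeE; apply/bigmax_leqP_seq => mu muG _.
  rewrite ltnS mdegE big_mxvec_index (eq_bigr (fun=> d)) => [|i _]; last exact: hG.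
  by rewrite sum_nat_const card_ord.
rewrite {1}(mpolywE szH); apply: eq_bigr => mu _; by rewrite ffunE.
Qed.

(** Numbers the pairs with larger columns first, so that each root subgroup comes after those of
    larger column, among which its commutators fall. *)
Definition root_code (i k : 'I_n.+1) := ((n - k) * n.+1 + i)%N.

Lemma root_code_inj i k j l : root_code i k = root_code j l -> i = j /\ k = l.
Proof.
move=> eqc; have eqi : i = j.
  move/(congr1 (modn^~ n.+1)): eqc; rewrite /root_code !modnMDl !modn_small //.
  exact: val_inj.
split=> //; move: eqc; rewrite /root_code eqi => /addIn/eqP; rewrite eqn_pmul2r // => /eqP eqk.
have kn : (k <= n)%N by rewrite -ltnS.
have ln : (l <= n)%N by rewrite -ltnS.
by apply: val_inj; rewrite /= -(subKn kn) eqk subKn.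
Qed.

Lemma root_code_lt_col i k j l : (k < l)%N -> (root_code j l < root_code i k)%N.
Proof.
move=> kl; have ln : (l <= n)%N by rewrite -ltnS.
apply: (@leq_trans ((n - l).+1 * n.+1)).
  by rewrite mulSn [X in (_ <= X)%N]addnC /root_code -addnS leq_add2l.
rewrite /root_code; apply: leq_trans (leq_addr _ _).
by rewrite leq_mul2r ltn_sub2l ?orbT //; apply: leq_trans kl ln.
Qed.

Lemma root_code_le_col i k j l : (root_code j l < root_code i k)%N -> (k <= l)%N.
Proof.
move=> lt_code; rewrite leqNgt; apply/negP => /(root_code_lt_col j i) /(ltn_trans lt_code).
by rewrite ltnn.
Qed.

Lemma root_code_bound i k : (root_code i k < n.+1 * n.+1)%N.
Proof.
rewrite /root_code; apply: (@leq_trans ((n - k).+1 * n.+1));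
  last by rewrite leq_mul2r ltnS leq_subr orbT.
by rewrite mulSn [X in (_ <= X)%N]addnC -addnS leq_add2l.
Qed.

Definition fixed_below c : set point := [set x | X x /\
  forall (j l : 'I_n.+1) s, (j < l)%N -> (root_code j l < c)%N -> act_point (root_elt j l s) x = x].

(** Moving an earlier root element past the one at (i,k) creates at most the extra element (i,l),
    with l > k. It is earlier as well, hence fixes [x]. *)
Lemma fixed_below_translate i k t x : (i < k)%N -> fixed_below (root_code i k) x ->
  X (act_point (root_elt i k t) x) -> fixed_below (root_code i k) (act_point (root_elt i k t) x).
Proof.
move=> ik [_ fx] Xtx; split=> // j l s jl lt_code.
have kl := root_code_le_col lt_code.
have li : l != i by rewrite -val_eqE /= gtn_eqF // (leq_trans ik).
rewrite -act_pointM; have [jk|jk] := eqVneq j k; last first.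
  by rewrite root_elt_commute // act_pointM (fx j l).
rewrite jk in jl lt_code *.
have lk : l != k by rewrite -val_eqE /= gtn_eqF.
have ik' : i != k by rewrite -val_eqE /= ltn_eqF.
rewrite root_elt_commutator // !act_pointM (fx i l) ?(fx k l) ?(ltn_trans ik) //.
exact: root_code_lt_col.
Qed.

Lemma rational_act_point i k t x : (i < k)%N -> X x ->
  X (act_point (root_elt i k t) x) <->
  act_point (root_elt i k (t ^+ Q)) x = act_point (root_elt i k t) x.
Proof.
move=> ik /rational_pointP[G [hG xG [H rH xH]]].
have H0 : H != 0.
  have [c c0 ->] : exists2 c, c != 0 & H = c *: G by apply/proj_point_eqP; rewrite -xH.
  by rewrite scaler_eq0 negb_or c0 chow_cycle_neq0.
rewrite xH !act_point_proj -rational_translate //; split.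
  by move/rational_pointP => [G' [_ _]].
move=> tH; apply/rational_pointP; exists (act (root_elt i k t) G).
split=> //; first by apply: chow_cycle_act => //; apply: unit_root_elt.
by rewrite -!act_point_proj -xH xG.
Qed.

Lemma card_fixed_below c (M : nat) : (X #= `I_M)%card ->
  exists2 M', (fixed_below c #= `I_M')%card & M = M' %[mod Q].
Proof.
move=> cardX; elim: c => [|c [M' cardc MM']].
  exists M => //; suff -> : fixed_below 0 = X by [].
  by apply/seteqP; split=> x; [case|move=> Xx; split].
(* A number that codes no pair i < k adds no condition, and the fixed set is unchanged. *)
have [[i [k [ik code_c]]]|nc] :=
    pselect (exists i k : 'I_n.+1, (i < k)%N /\ root_code i k = c); last first.
  exists M' => //; suff -> : fixed_below c.+1 = fixed_below c by [].
  apply/seteqP; split=> x [Xx fx]; split=> // j l s jl lt_c; apply: fx => //.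
    exact: leqW.
  move: lt_c; rewrite ltnS leq_eqVlt => /orP[/eqP eqc|//].
  by case: nc; exists j, l.
have [|s t x|x t|x|M'' card'' M'M''] :=
  @card_fixed_points K Q natQ Q_gt1 _ (fixed_below c)
    (fun t => act_point (root_elt i k t)) _ _ _ _ M' cardc.
- by move=> x; rewrite root_elt0 act_point1.
- by rewrite root_eltD // act_pointM.
- move=> Fx; have [Xx _] := Fx; rewrite -rational_act_point //.
  split=> [[]//|Xtx]; rewrite -code_c; apply: fixed_below_translate => //.
  by rewrite code_c.
- move=> [/rational_pointP[G [hG -> _]] _].
  have [fixG|[p p0 pr]] := translate_stabilizer (chow_cycle_neq0 hG) ik.
    by left=> t; rewrite act_point_proj fixG.
  by right; exists p => // t; rewrite act_point_proj => /pr.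
exists M''; last by rewrite MM'.
suff -> : fixed_below c.+1 = [set x | fixed_below c x /\
    forall t, act_point (root_elt i k t) x = x] by [].
apply/seteqP; split=> [x [Xx fx]|x [[Xx fx] fik]].
  split; first by split=> // j l s jl lt_c; apply: fx => //; apply: leqW.
  by move=> t; apply: fx; rewrite ?code_c.
split=> // j l s jl; rewrite ltnS leq_eqVlt => /orP[/eqP|]; last exact: fx.
by rewrite -code_c => /root_code_inj[-> ->].
Qed.

(** A root element with i < k preserves the standard plane, so the translated form has no zero off
    the minor; rigidity makes it a multiple of the same power. *)
Lemma act_lead_minor i k t : (i < k)%N ->
  exists2 c, c != 0 & act (root_elt i k t) (lead_minor K n m.+1 ^+ d) =
    c *: lead_minor K n m.+1 ^+ d.
Proof.
move=> ik; apply: (nonvanishing_multihomogeneous mn); last first.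
  exact/multihomogeneous_act/multihomogeneous_lead_minor.
move=> u; rewrite -meval_lead_minor meval_act rmorphXn /=; apply: contra_neq.
move/eqP; rewrite expf_eq0 => /andP[_ /eqP /(chow_zero_lead_minor _ mn)[x [[x0 xm] /= ux]]].
apply/(chow_zero_lead_minor _ mn); exists (root_elt i k t *m x); split; last by rewrite /= mulmxA.
split.
  by apply: contra_neq x0 => eq0; rewrite -(mulKmx (unit_root_elt t ik) x) eq0 mulmx0.
move=> j mj; rewrite root_elt_mulE xm // add0r; case: eqP => [ji|_]; last by rewrite mul0r.
by rewrite xm ?mulr0 //; apply: ltn_trans mj _; rewrite ji.
Qed.

(** The determinant commutes with ring morphisms, in particular with the Frobenius. *)
Lemma rational_lead_minor : rational_form Q (lead_minor K n m.+1 ^+ d).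
Proof.
apply/(rational_formP natQ Q_gt1) => v; rewrite !rmorphXn /= exprAC.
congr (_ ^+ d); pose u : 'M[K]_(m.+1, n.+1) := vec_mx (\row_l v l).
rewrite -(meval_mxvec_row _ v) meval_lead_minor -/u.
rewrite -(frobeniusE natQ Q_gt1) -(det_map_mx (frobenius natQ Q_gt1)).
rewrite (_ : map_mx _ (lead_cols _ u) =
    lead_cols m.+1 (map_mx (frobenius natQ Q_gt1) u)); last first.
  by apply/matrixP => a b; rewrite !mxE.
rewrite -meval_lead_minor; apply: meval_eq => l.
by rewrite -map_mxvec vec_mxK !mxE.
Qed.

Lemma fixed_below_all : fixed_below (n.+1 * n.+1) = [set proj_point (lead_minor K n m.+1 ^+ d)].
Proof.
apply/seteqP; split=> [x [/rational_pointP[G [hG -> _]] fx]|_ ->] /=.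
  have [i k t ik|c c0 ->] := fixed_chow_cycle mn hG; last by rewrite proj_pointZ.
  by apply/proj_point_eqP; rewrite -act_point_proj fx // root_code_bound.
split=> [|j l s jl _].
  apply/rational_pointP; exists (lead_minor K n m.+1 ^+ d).
  split=> //; first exact: chow_cycle_lead_minor.
  by exists (lead_minor K n m.+1 ^+ d) => //; exact: rational_lead_minor.
by rewrite act_point_proj; apply/proj_point_eqP; exact: act_lead_minor.
Qed.

Lemma card_rational_chow_points : exists2 M : nat, (X #= `I_M)%card & M = 1 %[mod Q].
Proof.
have /finite_setP[M cardX] := finite_rational_points.
have [M' cardM' MM'] := card_fixed_below (n.+1 * n.+1) cardX.
exists M; rewrite // MM'; suff -> : M' = 1%N by [].
apply/card_eq_II; rewrite card_eq_sym in cardM'; apply: card_eq_trans cardM' _.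
rewrite fixed_below_all.
set P := proj_point _; have -> : [set P] = (fun=> P) @` `I_1.
  by apply/seteqP; split=> [_ ->|_ [_ _ <-]//]; exists 0%N.
by apply: inj_card_eq => i j; rewrite !inE /=; case: i j => [|//] [].
Qed.

End RationalChowPoints.

(** The field F transmits its characteristic to K, so q^r is a power of the characteristic of K. The
    count holds modulo q^r and descends to q, which divides q^r because r >= 1. *)
Theorem mainTheorem8 (F : finFieldType) (q : nat) (hq : #|F| = q)
    (K : closedFieldType) (iota : {rmorphism F -> K})
    (hK : integralRange iota)
    (n m d r : nat) (hmn : (m <= n)%N) (hr : (1 <= r)%N) :
  exists2 N : nat,
    (rational_points (q ^ r)%N (chow_variety K n m d) #= `I_N)%card &
    (N = 1 %[mod q])%N.
Proof.
have [p pr_p charFp] := finPcharP F.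
have q_gt1 : (1 < q)%N by rewrite -hq finNzRing_gt1.
have natQ : [pchar K].-nat (q ^ r)%N.
  have -> : q = (p ^ logn p q)%N by rewrite -hq; exact: card_pprimeChar charFp.
  by rewrite !pnatX pnatE // (rmorph_pchar iota charFp).
have Q_gt1 : (1 < q ^ r)%N by rewrite -(exp1n r) ltn_exp2r.
have [N cardN N1] := card_rational_chow_points d hmn natQ Q_gt1.
exists N => //; rewrite -(@modn_dvdm (q ^ r) N) ?dvdn_exp //.
by rewrite N1 modn_dvdm // dvdn_exp.
Qed.
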